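(* For integers $p,q\ge 3$, the following eight equations are defining equations for the $\mathrm{PSL}$-$A$-polynomial of the double twist knot $K(p,q)$ (each expression is set equal to $0$): \begin{align*} \Delta_0:&\quad -m\,\gamma_{\mathcal{O}_0^2}\gamma_{\mathcal{O}_1^2}+l^{-1/2}\gamma_{\mathcal{O}_0^1}^2-\gamma_{E_0}\gamma_{E_1}\\ \Delta_1:&\quad m\,\gamma_{\mathcal{O}_0^1}\gamma_{\mathcal{O}_0^2}+\gamma_{\mathcal{O}_0^1}\gamma_{\mathcal{O}_1^2}-\gamma_{E_1}\gamma_{\mathcal{P}^2}\\ \Delta_2:&\quad l^{-1/2}m^{-1}\gamma_{\mathcal{O}_0^1}\gamma_{\mathcal{O}_0^2}+l^{-1/2}\gamma_{\mathcal{O}_0^1}\gamma_{\mathcal{O}_1^2}-\gamma_{E_0}\gamma_{\mathcal{P}^2}\\ \Delta_3:&\quad m^{-1}\gamma_{E_0}\gamma_{E_1}+l^{-1/2}m^{-1}\gamma_{\mathcal{O}_0^1}\gamma_{\mathcal{O}_1^1}-\gamma_{\mathcal{O}_0^2}^2\\ \Delta_4:&\quad \gamma_{\mathcal{O}_0^1}\gamma_{\mathcal{O}_0^2}+m\,\gamma_{\mathcal{O}_1^1}\gamma_{\mathcal{O}_0^2}-\gamma_{E_1}\gamma_{\mathcal{P}^1}\\ \Delta_5:&\quad m\,\gamma_{\mathcal{O}_0^1}\gamma_{\mathcal{O}_0^2}+\gamma_{\mathcal{O}_1^1}\gamma_{\mathcal{O}_0^2}-\gamma_{E_0}\gamma_{\mathcal{P}^1}\\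 \text{Tail 1}:&\quad H_{p-2}^1-\gamma_{\mathcal{O}_1^1}^{p-3}\gamma_{\mathcal{O}_0^1}^{p-2}\gamma_{\mathcal{P}^1}\\ \text{Tail 2}:&\quad H_{q-2}^2-\gamma_{\mathcal{O}_1^2}^{q-3}\gamma_{\mathcal{O}_0^2}^{q-2}\gamma_{\mathcal{P}^2} \end{align*} where, for $i\in\{1,2\}$ and $n\ge1$, $$H_n^i=\gamma_{\mathcal{O}_1^i}^{2n}+\sum_{\substack{a,b\ge 0\\ a+b\le n-1}}(-1)^{n-a-b}\binom{n-1-a}{b}\binom{n-b}{a}\,\gamma_{\mathcal{O}_1^i}^{2a}\,\gamma_{\mathcal{O}_0^i}^{2b}\,\gamma_{\mathcal{P}^i}^{2(n-a-b)}.$$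
   Context: Knots. The double twist knot $K(p,q)\subset S^3$ is the 2-bridge knot with exactly two twist regions, containing $2p$ and $2q$ negative crossings. Equivalently, $S^3-K(p,q)$ is obtained from the complement of the Borromean rings by $-1/p$ Dehn filling on one component and $-1/q$ Dehn filling on another (slope $1/n$ means $\mu+n\lambda$, with $\mu$ the meridian and $\lambda$ the homological longitude). Variables. $\gamma_{E_0},\gamma_{E_1},\gamma_{\mathcal{P}^1},\gamma_{\mathcal{P}^2},\gamma_{\mathcal{O}_0^1},\gamma_{\mathcal{O}_1^1},\gamma_{\mathcal{O}_0^2},\gamma_{\mathcal{O}_1^2}$ are formal variables (attached to edges of an ideal triangulation of $S^3-K(p,q)$); $m$ and $l$ are the variables (squares of eigenvalues, i.e. holonomies) of a chosen meridian and longitude of the knot; $l^{1/2}$ is a formal square root of $l$, related to the usual variables by $m=M^2$, $l^{1/2}=-L$. The triangulation and the choice of $m,l$. The triangulation has tetrahedra $\Delta_0,\dots,\Delta_5$ with ideal vertices labelled $0,1,2,3$ and face pairings (where $\Delta(ijk)\to\Delta'(i'j'k')$ means $i\mapsto i'$, $j\mapsto j'$, $k\mapsto k'$) $\Delta_0(012)\to\Delta_2(021)$, $\Delta_0(013)\to\Delta_1(201)$, $\Delta_0(023)\to\Delta_3(130)$, $\Delta_0(123)\to\Delta_5(213)$, $\Delta_1(013)\to\Delta_2(310)$, $\Delta_1(123)\to\Delta_4(213)$, $\Delta_2(123)\to\Delta_3(321)$, $\Delta_3(012)\to\Delta_4(210)$, $\Delta_3(023)\to\Delta_5(021)$, $\Delta_4(013)\to\Delta_5(310)$,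 together with tetrahedra $\Delta_j^1$ ($0\le j\le p-3$), $\Delta_j^2$ ($0\le j\le q-3$) forming two layered solid tori: $\Delta_0^1(012)\to\Delta_4(320)$, $\Delta_0^1(013)\to\Delta_5(230)$, $\Delta_0^2(012)\to\Delta_1(320)$, $\Delta_0^2(013)\to\Delta_2(230)$, and for $i=1,2$, with $r=p$ if $i=1$ and $r=q$ if $i=2$: $\Delta_{j+1}^i(012)\to\Delta_j^i(032)$, $\Delta_{j+1}^i(013)\to\Delta_j^i(213)$ for $0\le j\le r-4$, and $\Delta_{r-3}^i(023)\to\Delta_{r-3}^i(231)$ (folding). Edges: $E_0$ contains edge $12$ of $\Delta_0$; $E_1$ contains $03$ of $\Delta_0$; $\mathcal{O}_0^1,\mathcal{O}_1^1,\mathcal{P}^1$ contain edges $23,02,03$ of $\Delta_4$; $\mathcal{O}_0^2,\mathcal{O}_1^2,\mathcal{P}^2$ contain edges $23,02,03$ of $\Delta_1$. Give the edges $01,23$ / $02,13$ / $03,12$ of $\Delta_k$ shape parameters $z_k,z_k',z_k''$, with $z_kz_k'z_k''=-1$ and $z_k+(z_k')^{-1}-1=0$. The chosen meridian and longitude have cusp equations $m=-z_0'\,z_2z_2'\,z_3'$ and $l=z_0^2z_1^2z_2^{-2}z_3^{-2}(z_3')^{-2}(z_4')^{2}z_5^2$. Meaning of ''defining equations for the $\mathrm{PSL}$-$A$-polynomial''. The $\mathrm{PSL}(2,\mathbb{C})$ $A$-polynomial $A_K(M,L)$ of a knot $K$ is the analogue, for $\mathrm{PSL}(2,\mathbb{C})$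 representations of the knot group, of the $A$-polynomial of Cooper–Culler–Gillet–Long–Shalen, i.e. the polynomial relation between eigenvalues $M$ and $L$ of the meridian and longitude; solving the shape parameter, gluing and cusp equations of a triangulation in terms of $m$ and $l$ yields a factor of it (Champanerkar). A system of equations in $m,l$ and the $\gamma$'s is called a system of defining equations if, after setting one of the variables $\gamma$ equal to $1$ and solving the system in terms of $m$ and $l$ (eliminating the remaining $\gamma$'s), one obtains a factor of the $\mathrm{PSL}(2,\mathbb{C})$ $A$-polynomial $A_{K(p,q)}(M,L)$, where $m=M^2$ and $l^{1/2}=-L$.
   Formalization: Only solutions with m, l^{1/2} and all γ nonzero, and with H_n^1≠0 for 1≤n≤p−3 and H_n^2≠0 for 1≤n≤q−3, are eliminated; otherwise the claim fails: for p=4, Tail 1 has the factor γ_{O_1^1}+γ_{P^1}, which gives solutions belonging to K(2,q). *)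

(* Defs.v *)
From mathcomp Require Import all_boot all_order all_algebra.
From mathcomp Require Import polyXY complex reals.

Set Implicit Arguments.
Unset Strict Implicit.
Unset Printing Implicit Defensive.

Import GRing.Theory.
Local Open Scope ring_scope.

(* (x, false) stands for the generator x and (x, true) for its inverse. *)
Definition word (G : Type) := seq (G * bool).

Definition word_inv (G : Type) (w : word G) : word G :=
  rev [seq (x.1, ~~ x.2) | x <- w].

Definition word_pow (G : Type) (w : word G) (k : nat) : word G :=
  flatten (nseq k w).

Definition word_eval (G : Type) (V : unitRingType) (rho : G -> V)
    (w : word G) : V :=
  \prod_(x <- w) (if x.2 then (rho x.1)^-1 else rho x.1).

Record knot_group := KnotGroup {
  generator : Type;
  relators  : seq (word generator);
  meridian  : word generator;
  longitude : word generator
}.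

Record crossing (G : Type) := Crossing {
  over : G; under_in : G; under_out : G; positive : bool
}.

(* What a curve parallel to the under-strand picks up at the crossing: over^e,
   where e = 1 or -1 is the sign of the crossing. *)
Definition passing (G : Type) (c : crossing G) : word G :=
  [:: (over c, ~~ positive c)].

(* under_out = over^-e * under_in * over^e *)
Definition wirtinger_relator (G : Type) (c : crossing G) : word G :=
  (under_out c, true) ::
    word_inv (passing c) ++ (under_in c, false) :: passing c.

(* The Borromean rings as three round circles A, B, C with centres at the
   directions 90, 210 and 330 degrees, all oriented counterclockwise, with A over
   B, B over C, C over A at both of their crossings. Each circle X consists of
   two arcs: X1 starts at the outer crossing where X is the lower strand and ends
   at the inner one, and X2 runs back. All outer crossings are negative and all
   inner ones positive. *)
Inductive arc := A1 | A2 | B1 | B2 | C1 | C2.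

Definition innerA := Crossing C2 A1 A2 true.
Definition outerA := Crossing C1 A2 A1 false.
Definition innerB := Crossing A2 B1 B2 true.
Definition outerB := Crossing A1 B2 B1 false.
Definition innerC := Crossing B2 C1 C2 true.
Definition outerC := Crossing B1 C2 C1 false.

Definition borromean_relators : seq (word arc) :=
  map (@wirtinger_relator arc)
    [:: innerA; outerA; innerB; outerB; innerC; outerC].

Definition muA : word arc := [:: (A1, false)].
Definition muB : word arc := [:: (B1, false)].
Definition muC : word arc := [:: (C1, false)].

(* Homological longitudes, based at A1, B1 and C1: no component crosses itself,
   so there is no framing correction. *)
Definition lambdaA : word arc := passing innerA ++ passing outerA.
Definition lambdaB : word arc := passing innerB ++ passing outerB.
Definition lambdaC : word arc := passing innerC ++ passing outerC.

(* The curve mu - n lambda, of slope -1/n. *)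
Definition slope_minus_inv (mu lambda : word arc) (n : nat) : word arc :=
  mu ++ word_pow (word_inv lambda) n.

(* S^3 - K(p, q): slopes -1/p and -1/q are filled on the components A and B of
   the Borromean rings, and C becomes the knot. Since C has linking number 0
   with A and B, lambdaC remains its homological longitude.

   The longitude is oriented against lambdaC. The pair of peripheral curves
   whose cusp equations are m = - z0' z2 z2' z3' and
   l = z0^2 z1^2 z2^-2 z3^-2 z3'^-2 z4'^2 z5^2 is, up to inverting both curves
   simultaneously, (muC, - lambdaC) for the knot K(p, q) with negative
   crossings, e.g. K(1, 1) is the left-handed trefoil. *)
Definition double_twist_knot (p q : nat) : knot_group := {|
  generator := arc;
  relators  := borromean_relators ++
                 [:: slope_minus_inv muA lambdaA p;
                     slope_minus_inv muB lambdaB q];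
  meridian  := muC;
  longitude := word_inv lambdaC
|}.

(* A bivariate polynomial g is evaluated as g.[x, y], where x replaces the outer
   variable 'X and y the inner variable 'Y. *)

Definition vanishes_on (C : fieldType) (S : C -> C -> Prop)
    (g : {poly {poly C}}) : Prop :=
  forall x y, S x y -> g.[x, y] = 0.

Definition zariski_closure (C : fieldType) (S : C -> C -> Prop)
    (x y : C) : Prop :=
  forall g : {poly {poly C}}, vanishes_on S g -> g.[x, y] = 0.

Definition nonconstant (C : fieldType) (g : {poly {poly C}}) : Prop :=
  ~ exists c : C, g = c%:P%:P.

(* The union of the plane curves contained in the Zariski closure of S; if S is
   not dense, this is the union of the one-dimensional irreducible components
   of the closure. *)
Definition curve_part (C : fieldType) (S : C -> C -> Prop) (x y : C) : Prop :=
  exists g : {poly {poly C}},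
    [/\ nonconstant g,
        forall u v, g.[u, v] = 0 -> zariski_closure S u v
      & g.[x, y] = 0].

(* f is nonzero and generates the ideal of the curve part of S. *)
Definition defining_polynomial (C : fieldType) (S : C -> C -> Prop)
    (f : {poly {poly C}}) : Prop :=
  f <> 0 /\
  forall g : {poly {poly C}},
    vanishes_on (curve_part S) g <-> exists h, g = h * f.

(* rho chooses a matrix of determinant 1 over the image of each generator in
   PSL(2, C) = SL(2, C) / {1, -1}; the relations hold up to sign. *)
Definition PSL_representation (C : fieldType) (K : knot_group)
    (rho : generator K -> 'M[C]_2) : Prop :=
  (forall x, \det (rho x) = 1) /\
  (forall i, (i < size (relators K))%N ->
     let g := word_eval rho (nth [::] (relators K) i) in g = 1 \/ g = - 1).

(* X is upper triangular and represents the class of (a, b; 0, a^-1). *)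
Definition upper_triangular_with (C : fieldType) (X : 'M[C]_2) (a : C) : Prop :=
  X 1 0 = 0 /\ (X 0 0 = a \/ X 0 0 = - a).

Definition PSL_eigenvalues (C : fieldType) (K : knot_group) (M L : C) : Prop :=
  exists rho : generator K -> 'M[C]_2,
    [/\ PSL_representation rho,
        upper_triangular_with (word_eval rho (meridian K)) M
      & upper_triangular_with (word_eval rho (longitude K)) L].

(* Defined up to a nonzero constant. *)
Definition is_PSL_A_polynomial (C : fieldType) (K : knot_group)
    (A : {poly {poly C}}) : Prop :=
  defining_polynomial (@PSL_eigenvalues C K) A.

Inductive tail := tail1 | tail2.

Inductive edge := E0 | E1 | EP of tail | EO0 of tail | EO1 of tail.

Definition H (C : fieldType) (gamma : edge -> C) (i : tail) (n : nat) : C :=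
  gamma (EO1 i) ^+ (2 * n) +
  \sum_(a < n) \sum_(b < n | (a + b <= n.-1)%N)
    (-1) ^+ (n - a - b) * ('C(n.-1 - a, b))%:R * ('C(n - b, a))%:R *
    gamma (EO1 i) ^+ (2 * a) * gamma (EO0 i) ^+ (2 * b) *
    gamma (EP i) ^+ (2 * (n - a - b)).

Definition tail_equation (C : fieldType) (gamma : edge -> C) (i : tail)
    (r : nat) : C :=
  H gamma i (r - 2) -
  gamma (EO1 i) ^+ (r - 3) * gamma (EO0 i) ^+ (r - 2) * gamma (EP i).

(* s is the square root l^{1/2}. *)
Definition equations (C : fieldType) (p q : nat) (m s : C)
    (gamma : edge -> C) : seq C :=
  let e0 := gamma E0 in
  let e1 := gamma E1 in
  let P1 := gamma (EP tail1) in
  let P2 := gamma (EP tail2) in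
  let O01 := gamma (EO0 tail1) in
  let O11 := gamma (EO1 tail1) in
  let O02 := gamma (EO0 tail2) in
  let O12 := gamma (EO1 tail2) in
  [:: - (m * O02 * O12) + s^-1 * O01 ^+ 2 - e0 * e1;
      m * O01 * O02 + O01 * O12 - e1 * P2;
      s^-1 * m^-1 * O01 * O02 + s^-1 * O01 * O12 - e0 * P2;
      m^-1 * e0 * e1 + s^-1 * m^-1 * O01 * O11 - O02 ^+ 2;
      O01 * O02 + m * O11 * O02 - e1 * P1;
      m * O01 * O02 + O11 * O02 - e0 * P1;
      tail_equation gamma tail1 p;
      tail_equation gamma tail2 q].

(* The layered solid torus i has edges O_0^i, ..., O_(r-2)^i, and the variables
   with index at least 2 are eliminated from the equations by
     gamma_(O_(n+1)) = H_n / (gamma_(O_1)^(n-1) * gamma_(O_0)^n).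
   They are variables attached to edges, hence nonzero like the others. This
   cannot be dropped: for r >= 4 the tail equation also has the solutions
   gamma_(O_(r-2)) = 0, which come from representations of the knot group in
   which r is replaced by r - 2. *)
Definition inner_edges_nonzero (C : fieldType) (gamma : edge -> C) (i : tail)
    (r : nat) : Prop :=
  forall n, (1 <= n <= r - 3)%N -> H gamma i n <> 0.

Definition is_solution (C : fieldType) (p q : nat) (m s : C)
    (gamma : edge -> C) : Prop :=
  [/\ m <> 0 /\ s <> 0,
      forall e, gamma e <> 0,
      inner_edges_nonzero gamma tail1 p,
      inner_edges_nonzero gamma tail2 q
    & forall x, x \in equations p q m s gamma -> x = 0].

Definition eliminated (C : fieldType)
    (solution : C -> C -> (edge -> C) -> Prop) (e : edge) (m s : C) : Prop :=
  exists gamma : edge -> C, gamma e = 1 /\ solution m s gamma.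

(* f(M^2, - L) as a polynomial in M = 'X and L = 'Y. *)
Definition substitute_eigenvalues (C : fieldType) (f : {poly {poly C}}) :
    {poly {poly C}} :=
  map_poly (fun c : {poly C} => c \Po (- 'X)) f \Po 'X^2.

Definition are_defining_equations (C : fieldType) (K : knot_group)
    (solution : C -> C -> (edge -> C) -> Prop) : Prop :=
  forall e : edge, exists f : {poly {poly C}},
    [/\ defining_polynomial (eliminated solution e) f,
        nonconstant f
      & forall A, is_PSL_A_polynomial K A ->
          exists h, A = h * substitute_eigenvalues f].

(* Main.v *)
(* Eliminating the inner edges of a layered solid torus with edge variables O_0, O_1, P,
   put x = (O_0^2 + O_1^2 - P^2) / (O_0 O_1). The recursion behind H_n becomes the
   Chebyshev recursion, and the tail equation says O_0 = P [r]_x and O_1 = P [r-1]_x,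
   where [0]_x = 0, [1]_x = 1, [k+2]_x = x [k+1]_x - [k]_x. Writing A = [p]_x,
   A' = [p-1]_x, B = [q]_y, B' = [q-1]_y and mu = m + 1/m, the six remaining equations
   reduce to
     A + A' + (y + mu) A B (B + B') = 0   and   (x + mu) (y + mu) A^2 B^2 = 1,
   and express l^{1/2} as a rational function of m, x and y.
   - These relations give a polynomial equation for y over C[m], and by symmetry one for
     x; so l^{1/2} is algebraic over C[m], and the solutions lie on a plane curve.
   - Eliminating mu gives the curve
       ([p+1]_x + [p]_x) ([q]_y + [q-1]_y) = ([p]_x + [p-1]_x) ([q+1]_y + [q]_y),
     which has points over all but finitely many y, so the solution set is infinite.
   - For a solution, - x is the trace of C2 C1^-1 and - y the trace of
     A2 A1^-1 in an explicit representation of the knot group with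
     C1 = [M, 1; 0, 1/M] and C2 = [M, 0; x + 2, 1/M], whose longitude has eigenvalue
     - l^{1/2}. Hence an A-polynomial vanishes at (M, - l^{1/2}) and (- M, - l^{1/2}) for
     almost all solutions, and f divides its even and odd parts in M. *)
Require Import Defs.
From mathcomp Require Import all_boot all_order all_algebra.
From mathcomp Require Import polyXY complex boolp reals.
From mathcomp Require Import ring zify.

Set Implicit Arguments.
Unset Strict Implicit.
Unset Printing Implicit Defensive.

Import GRing.Theory Num.Theory.
Local Open Scope ring_scope.

(** * Plane curves *)


(** The pattern of most identities below: [c] is a combination of known relations, [ring] checks
    that [a - b] equals it, and rewriting with the relations makes it vanish. *)
Lemma eqr_comb0 (K : pzRingType) (a b c : K) : a - b = c -> c = 0 -> a = b.
Proof. by move=> <- /eqP; rewrite subr_eq0 => /eqP. Qed.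

Lemma nat_ind2 (T : nat -> Prop) :
  T 0%N -> T 1%N -> (forall n, T n -> T n.+1 -> T n.+2) -> forall n, T n.
Proof.
move=> T0 T1 TSS n; suff [] : T n /\ T n.+1 by [].
by elim: n => [|n [Tn TSn]]; split => //; apply: TSS.
Qed.

Lemma ex_min_measure (T : Type) (P : T -> Prop) (mu : T -> nat) :
  (exists t, P t) -> exists2 t, P t & forall t', P t' -> (mu t <= mu t')%N.
Proof.
move=> [t0 Pt0]; pose Q n := `[< exists2 t, P t & mu t = n >].
have exQ : exists n, Q n by exists (mu t0); apply/asboolP; exists t0.
case: (ex_minnP exQ) => n /asboolP[t Pt <-] nmin; exists t => // t' Pt'.
by apply: nmin; apply/asboolP; exists t'.
Qed.

Lemma horner2E (K : comNzRingType) (g : {poly {poly K}}) (x y : K) :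
  g.[x, y] = (map_poly (horner_eval y) g).[x].
Proof. by rewrite -horner_swapXY horner2_swapXY. Qed.

Lemma horner2M (K : comNzRingType) (g h : {poly {poly K}}) (x y : K) :
  (g * h).[x, y] = g.[x, y] * h.[x, y].
Proof. by rewrite !hornerM. Qed.

Section PlaneCurves.
Variable C : closedFieldType.
Implicit Types (S : C -> C -> Prop) (f g h u : {poly {poly C}}).
Implicit Types (p : {poly C}) (F : seq (C * C)).

Lemma poly_roots_seq p : p != 0 -> exists r : seq C, forall x, root p x -> x \in r.
Proof.
move=> p0; have [r Dp] := closed_field_poly_normal p.
exists r => x; rewrite Dp rootZ ?lead_coef_eq0 //.
by rewrite root_prod_XsubC.
Qed.

Lemma poly_eq0_off_seq p (r : seq C) :
  (forall x, x \notin r -> p.[x] = 0) -> p = 0.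
Proof.
move=> p0; apply/eqP; apply/negPn/negP => nz.
pose P := p * \prod_(a <- r) ('X - a%:P).
have Pn : P != 0 by rewrite mulf_neq0 // monic_neq0 // monic_prod_XsubC.
have PX : forall x, P.[x] = 0.
  move=> x; rewrite /P hornerM; case: (boolP (x \in r)) => xr.
    suff /rootP -> : root (\prod_(a <- r) ('X - a%:P)) x by rewrite mulr0.
    by rewrite root_prod_XsubC.
  by rewrite p0 ?mul0r.
(* If [P] is nonzero and vanishes everywhere, [P * 'X + 1] is nonconstant without roots, which
   algebraic closedness forbids. *)
have [|x] := closed_rootP (P * 'X + 1) _.
  by rewrite -polyC1 size_MXaddC (negPf Pn) /= eqSS size_poly_eq0.
by rewrite /root hornerD hornerMX PX mul0r add0r hornerC oner_eq0.
Qed.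

Lemma map_horner_eval_factor g (c : C) :
  map_poly (horner_eval c) g = 0 -> exists g1, g = ('X - c%:P)%:P * g1.
Proof.
move=> g0; exists (map_poly (fun a => a %/ ('X - c%:P)) g).
apply/polyP => i; rewrite coefCM coef_map_id0 ?div0p //.
rewrite mulrC divpK // dvdp_XsubCl; apply/rootP.
by have := congr1 (fun q : {poly C} => q`_i) g0; rewrite coef_map coef0.
Qed.

(* Off a finite set: the exceptional points are the ones that curve_part discards. *)
Definition vanishes_almost_on S g :=
  exists F, forall x y, S x y -> (x, y) \notin F -> g.[x, y] = 0.

Lemma vanishes_on_almost S g : vanishes_on S g -> vanishes_almost_on S g.
Proof. by move=> Sg; exists [::] => x y /Sg. Qed.

Lemma vanishes_almost_comb S g h u1 u2 :
  vanishes_almost_on S g -> vanishes_almost_on S h ->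
  vanishes_almost_on S (u1 * g + u2 * h).
Proof.
move=> [F Fg] [F' Fh]; exists (F ++ F') => x y Sxy.
rewrite mem_cat negb_or => /andP[xF xF'].
by rewrite !hornerE /= (Fg _ _ Sxy xF) (Fh _ _ Sxy xF') !mulr0 addr0.
Qed.

Lemma vanishes_almost_mul S g u1 :
  vanishes_almost_on S g -> vanishes_almost_on S (u1 * g).
Proof.
by move=> Sg; have := vanishes_almost_comb u1 0 Sg Sg; rewrite mul0r addr0.
Qed.

(* f has minimal degree in 'X and then a leading coefficient of minimal degree. Pseudo-division
   gives a g = q f with a in C['Y]; a linear factor 'Y - c of a that divides f, but not q, would
   make the line 'Y = c a component met infinitely often, and hence divide g as well. *)
Lemma almost_ideal_principal S g0 : g0 != 0 -> vanishes_almost_on S g0 ->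
  exists2 f, f != 0 & forall g, vanishes_almost_on S g <-> exists h, g = h * f.
Proof.
move=> g0n Sg0.
have [f1 [f1n Sf1] f1min] := @ex_min_measure _
  (fun f => f != 0 /\ vanishes_almost_on S f) (fun f => size f)
  (ex_intro _ g0 (conj g0n Sg0)).
have [f [fn Sf szf] fmin] := @ex_min_measure _
  (fun f => [/\ f != 0, vanishes_almost_on S f & size f = size f1])
  (fun f => size (lead_coef f)) (ex_intro _ f1 (And3 f1n Sf1 erefl)).
exists f => // g; split; last by move=> [h ->]; apply: vanishes_almost_mul.
move=> Sg.
have [a0 [a0n [q0 Dq0]]] : exists a : {poly C}, a != 0 /\ exists q, a%:P * g = q * f.
  exists (lead_coef f ^+ scalp g f); split.
    by rewrite expf_neq0 // lead_coef_eq0.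
  exists (g %/ f); have := Pdiv.Idomain.divp_eq g f; rewrite -mul_polyC => E.
  rewrite E; suff -> : g %% f = 0 by rewrite addr0.
  apply/eqP; apply/negPn/negP => rn.
  have : (size f <= size (g %% f)%R)%N.
    rewrite szf; apply: f1min; split => //.
    have -> : g %% f = (lead_coef f ^+ scalp g f)%:P * g + (- (g %/ f)) * f.
      by rewrite E mulNr addrAC subrr add0r.
    exact: vanishes_almost_comb.
  by rewrite leqNgt ltn_modp fn.
have [a [an [q Dq]] amin] := @ex_min_measure _
  (fun a : {poly C} => a != 0 /\ exists q, a%:P * g = q * f) (fun a => size a)
  (ex_intro _ a0 (conj a0n (ex_intro _ q0 Dq0))).
have [/size_poly1P[c cn Da]|/closed_rootP[c ac]] := boolP (size a == 1%N).
  exists (c^-1%:P%:P * q); rewrite -mulrA -Dq Da mulrA -!polyCM mulVf //.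
  by rewrite !polyC1 mul1r.
have {ac} /factor_theorem[a1 Da] := ac.
have Xcn : ('X - c%:P)%:P != 0 :> {poly {poly C}}.
  by rewrite polyC_eq0 polyXsubC_eq0.
have a1n : a1 != 0 by apply: contraNneq an => a10; rewrite Da a10 mul0r.
have a_bad q1 : q <> ('X - c%:P)%:P * q1.
  move=> Dq1; have : (size a <= size a1)%N.
    apply: amin; split => //; exists q1; apply: (mulfI Xcn).
    by rewrite !mulrA -polyCM [_ * a1]mulrC -Da Dq Dq1.
  by rewrite Da size_Mmonic ?monicXsubC // size_XsubC addn2 /= ltnn.
have ev0 : map_poly (horner_eval c) q * map_poly (horner_eval c) f = 0.
  rewrite -rmorphM -Dq rmorphM /= map_polyC /= Da /horner_eval hornerM.
  by rewrite hornerXsubC subrr mulr0 mul0r.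
have /orP[/eqP/map_horner_eval_factor[q1 /a_bad]//|] : 
  (map_poly (horner_eval c) q == 0) || (map_poly (horner_eval c) f == 0).
  by rewrite -mulf_eq0 ev0.
move=> /eqP/map_horner_eval_factor[f2 Df].
have nSf2 f3 : vanishes_almost_on S f3 -> f = ('X - c%:P)%:P * f3 -> False.
  move=> Sf3 Df3.
  have f3n : f3 != 0 by apply: contraNneq fn => f30; rewrite Df3 f30 mulr0.
  have : (size (lead_coef f) <= size (lead_coef f3))%N.
    apply: fmin; split => //.
    by rewrite -szf Df3 mul_polyC size_scale // -polyC_eq0.
  rewrite Df3 lead_coefM lead_coefC size_mul ?lead_coef_eq0 // ?polyXsubC_eq0 //.
  by rewrite size_XsubC /= ltnn.
(* Otherwise [g] has finitely many zeros on the line 'Y = c; adding them to the exceptional set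
   makes [f2] vanish almost everywhere on [S]. *)
have gc : map_poly (horner_eval c) g = 0.
  apply/eqP; apply/negPn/negP => gcn.
  have [r Hr] := poly_roots_seq gcn.
  have [Ff HF] := Sf; have [Fg HG] := Sg.
  apply: (nSf2 f2) => //; exists (Ff ++ Fg ++ [seq (x, c) | x <- r]) => x y Sxy.
  rewrite !mem_cat !negb_or => /and3P[xF xG xr].
  have := HF _ _ Sxy xF; rewrite Df horner2M hornerC hornerXsubC => /eqP.
  rewrite mulf_eq0 => /orP[|/eqP//]; rewrite subr_eq0 => /eqP yc.
  case/negP: xr; apply/mapP; exists x; last by rewrite yc.
  by apply: Hr; apply/rootP; rewrite -horner2E -yc; apply: HG.
have [g1 Dg] := map_horner_eval_factor gc.
have E1 : a%:P * g1 = q * f2.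
  by apply: (mulfI Xcn); rewrite mulrCA -Dg Dq Df mulrCA.
have /eqP : map_poly (horner_eval c) q * map_poly (horner_eval c) f2 = 0.
  rewrite -rmorphM -E1 rmorphM /= map_polyC /= Da /horner_eval hornerM.
  by rewrite hornerXsubC subrr mulr0 mul0r.
rewrite mulf_eq0 => /orP[/eqP/map_horner_eval_factor[q1 /a_bad]//|].
move=> /eqP/map_horner_eval_factor[f3 Df2].
(* Now 'Y - c divides [f] twice, so [f2] has the same zeros as [f] and contradicts its
   minimality. *)
exfalso; apply: (nSf2 f2) => //; have [Ff HF] := Sf; exists Ff => x y Sxy xF.
have := HF _ _ Sxy xF; rewrite Df Df2 !horner2M hornerC hornerXsubC => /eqP.
by rewrite !mulf_eq0 orbA orbb => /orP[/eqP->|/eqP->]; rewrite ?mul0r ?mulr0.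
Qed.

(** A Nullstellensatz in one variable whose exponent depends only on the degree of [p], so that one
    exponent serves almost all specialisations of a bivariate polynomial. *)
Lemma dvdp_exp_roots p (g : {poly C}) : p != 0 ->
  (forall x, root p x -> root g x) -> p %| g ^+ size p.
Proof.
move=> p0 pg; have [r Dp] := closed_field_poly_normal p.
have szp : size p = (size r).+1.
  by rewrite {1}Dp size_scale ?lead_coef_eq0 // size_prod_XsubC.
have rg : all (root g) r.
  apply/allP => x xr; apply: pg.
  by rewrite Dp rootZ ?lead_coef_eq0 // root_prod_XsubC.
rewrite Dp dvdpZl ?lead_coef_eq0 // -Dp szp exprS; apply: dvdp_mull.
elim: r rg {Dp szp} => [|x r IH] /=; first by rewrite big_nil dvd1p.
by move=> /andP[gx /IH rr]; rewrite big_cons exprS dvdp_mul // dvdp_XsubCl.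
Qed.

(* A plane curve u has no isolated points: if g vanishes on it off a finite set then u divides
   c g^N for some c in C['Y], and c can be taken nonzero at the ordinate of a given point. *)
Lemma vanishes_on_curve_almost S g : vanishes_almost_on S g ->
  vanishes_on (curve_part S) g.
Proof.
move=> [F HF] x0 y0 [u [unc uS u00]].
(* Lines through the exceptional points: [a g] and [b g] vanish on all of [S], hence on the curve
   [u]. The factor [b] is for the case that [u] contains the line 'Y = y0. *)
pose a : {poly C} := \prod_(z <- F) ('X - z.2%:P).
pose b : {poly C} := \prod_(z <- F) ('X - z.1%:P).
have an : a != 0.
  rewrite /a -(big_map snd predT (fun c => 'X - c%:P)).
  by rewrite monic_neq0 // monic_prod_XsubC.
have bn : b != 0.
  rewrite /b -(big_map fst predT (fun c => 'X - c%:P)).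
  by rewrite monic_neq0 // monic_prod_XsubC.
have ab0 x y : (x, y) \in F -> a.[y] = 0 /\ b.[x] = 0.
  move=> xyF; split; apply/rootP.
    rewrite /a -(big_map snd predT (fun c => 'X - c%:P)) root_prod_XsubC.
    by apply/mapP; exists (x, y).
  rewrite /b -(big_map fst predT (fun c => 'X - c%:P)) root_prod_XsubC.
  by apply/mapP; exists (x, y).
have agV x y : u.[x, y] = 0 -> a.[y] * g.[x, y] = 0.
  move=> /uS/(_ (a%:P * g)); rewrite horner2M hornerC; apply => x' y' Sxy.
  rewrite horner2M hornerC; case: (boolP ((x', y') \in F)) => [/ab0[-> _]|].
    by rewrite mul0r.
  by move=> /HF->//; rewrite mulr0.
have bgV x y : u.[x, y] = 0 -> b.[x] * g.[x, y] = 0.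
  have bE z w : (map_poly polyC b).[z, w] = b.[z].
    rewrite horner2E -map_poly_comp map_poly_id // => c _ /=.
    by rewrite /horner_eval hornerC.
  move=> /uS/(_ (map_poly polyC b * g)); rewrite horner2M bE; apply => x' y' Sxy.
  rewrite horner2M bE; case: (boolP ((x', y') \in F)) => [/ab0[_ ->]|].
    by rewrite mul0r.
  by move=> /HF->//; rewrite mulr0.
have [uy0|uy0] := eqVneq (map_poly (horner_eval y0) u) 0.
  have [r Hr] := poly_roots_seq bn.
  rewrite horner2E; suff -> : map_poly (horner_eval y0) g = 0 by rewrite horner0.
  apply: (@poly_eq0_off_seq _ r) => x xr; rewrite -horner2E.
  have /bgV/eqP : u.[x, y0] = 0 by rewrite horner2E uy0 horner0.
  rewrite mulf_eq0 => /orP[bx|/eqP//]; case/negP: xr; exact: Hr.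
have un : u != 0 by apply: contraNneq uy0 => ->; rewrite rmorph0.
have [N [k [q [r [Eq szr Nn]]]]] : exists N k q r,
    [/\ (lead_coef u ^+ k)%:P * g ^+ N = q * u + r, (size r < size u)%N & N = size u].
  exists (size u), (scalp (g ^+ size u) u), (g ^+ size u %/ u), (g ^+ size u %% u).
  by rewrite mul_polyC Pdiv.Idomain.divp_eq ltn_modp un.
have ln : lead_coef u != 0 by rewrite lead_coef_eq0.
(* For almost every ordinate, [u] keeps its degree and divides [g ^+ N], so the remainder, being of
   smaller degree, specialises to 0. *)
have r0 : r = 0.
  have [rs Hrs] := poly_roots_seq (mulf_neq0 an ln).
  apply/polyP => i; rewrite coef0; apply: (@poly_eq0_off_seq _ rs) => y yrs.
  have /andP[ay ly] : (a.[y] != 0) && ((lead_coef u).[y] != 0).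
    by rewrite -negb_or -mulf_eq0 -hornerM; apply: contra yrs => /Hrs.
  pose e := map_poly (horner_eval y).
  have szu : size (e u) = size u by rewrite size_map_poly_id0.
  have eun : e u != 0 by rewrite -size_poly_eq0 szu size_poly_eq0.
  have d1 : e u %| e g ^+ N.
    rewrite Nn -szu; apply: dvdp_exp_roots => // x /rootP; rewrite -horner2E.
    move=> /agV/eqP; rewrite mulf_eq0 (negPf ay) /= => /eqP gx.
    by apply/rootP; rewrite -horner2E.
  have : e u %| e r.
    have -> : e r = (lead_coef u ^+ k).[y]%:P * e g ^+ N - e q * e u.
      have := congr1 e Eq; rewrite /e !(rmorphM, rmorphD, rmorphXn) /= map_polyC /=.
      by rewrite /horner_eval horner_exp polyC_exp => ->; rewrite addrAC subrr add0r.
    by rewrite dvdp_sub ?dvdp_mull.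
  have [er0 _|ern /(dvdp_leq ern)] := eqVneq (e r) 0.
    by rewrite -[LHS](coef_map (horner_eval y)) -/e er0 coef0.
  by rewrite szu leqNgt (leq_ltn_trans (size_poly _ _) szr).
have lkn : lead_coef u ^+ k != 0 by rewrite expf_neq0.
have [c [cn [q1 Dq1]] cmin] := @ex_min_measure _
  (fun c : {poly C} => c != 0 /\ exists q, c%:P * g ^+ N = q * u) (fun c => size c)
  (ex_intro _ (lead_coef u ^+ k) (conj lkn (ex_intro _ q
    (etrans Eq (etrans (congr1 _ r0) (addr0 _)))))).
have cy0 : c.[y0] != 0.
  apply/negP => /factor_theorem[c1 Dc].
  have c1n : c1 != 0 by apply: contraNneq cn => c10; rewrite Dc c10 mul0r.
  have : map_poly (horner_eval y0) q1 * map_poly (horner_eval y0) u = 0.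
    rewrite -rmorphM -Dq1 rmorphM /= map_polyC /= Dc /horner_eval hornerM.
    by rewrite hornerXsubC subrr mulr0 mul0r.
  move/eqP; rewrite mulf_eq0 (negPf uy0) orbF => /eqP/map_horner_eval_factor[q2 Dq2].
  have : (size c <= size c1)%N.
    apply: cmin; split => //; exists q2.
    have Xn : ('X - y0%:P)%:P != 0 :> {poly {poly C}}.
      by rewrite polyC_eq0 polyXsubC_eq0.
    by apply: (mulfI Xn); rewrite !mulrA -polyCM [_ * c1]mulrC -Dc Dq1 Dq2.
  by rewrite Dc size_Mmonic ?monicXsubC // size_XsubC addn2 /= ltnn.
have := congr1 (fun P : {poly {poly C}} => P.[x0, y0]) Dq1.
rewrite !horner2M u00 mulr0 hornerC !horner_exp => /eqP.
by rewrite mulf_eq0 (negPf cy0) expf_eq0 => /andP[_ /eqP].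
Qed.

(** The generator [f] of the ideal of [almost_ideal_principal] divides everything that vanishes on
    [S], so its zero set lies in the closure and, if [f] is nonconstant, in the curve part; it
    contains almost all of [S]. If [f] is constant, [S] is finite. *)
Lemma curve_part_vanishes_almost S g0 g : g0 != 0 -> vanishes_almost_on S g0 ->
  vanishes_on (curve_part S) g <-> vanishes_almost_on S g.
Proof.
move=> g0n Sg0; split; last exact: vanishes_on_curve_almost.
have [f fn Hf] := almost_ideal_principal g0n Sg0.
have [F HF] : vanishes_almost_on S f by apply/Hf; exists 1; rewrite mul1r.
have [fc Vg|fnc Vg] := pselect (exists c, f = c%:P%:P).
  have [c Dc] := fc; apply/Hf; exists (c^-1%:P%:P * g).
  rewrite Dc mulrAC -!polyCM mulVf ?polyC1 ?mul1r //.
  by apply: contraNneq fn => c0; rewrite Dc c0.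
exists F => x y Sxy xF; apply: Vg; exists f; split => //; last exact: HF.
move=> v w fvw h Sh; have [|h' ->] := (Hf h).1; first exact: vanishes_on_almost.
by rewrite horner2M fvw mulr0.
Qed.

End PlaneCurves.

(** * Algebraic functions *)


Section AlgebraicFunctions.
Variable C : closedFieldType.

(** Algebraic dependence is stated pointwise, on an arbitrary index set: the solutions need not form
    an irreducible variety with a function field. *)
Definition algebraic_over (W : Type) (m phi : W -> C) :=
  exists2 G : {poly {poly C}}, G != 0 & forall w, G.[phi w, m w] = 0.

(** The resultants behind [sub_annihilant] and [div_annihilant] need positive degree in 'X, which
    the factor 'X - 1 provides. *)
Lemma algebraic_over_wide (W : Type) (m phi : W -> C) :
  algebraic_over m phi ->
  exists G : {poly {poly C}},
    [/\ G != 0, (1 < size G)%N & forall w, G.[phi w, m w] = 0].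
Proof.
move=> [G Gn HG]; exists (('X - 1) * G); split=> [||w].
- by rewrite mulf_neq0 // -polyC1 polyXsubC_eq0.
- rewrite size_mul //; last by rewrite -polyC1 polyXsubC_eq0.
  by rewrite -polyC1 size_XsubC /= ltnS size_poly_gt0.
- by rewrite horner2M HG mulr0.
Qed.

(** Factors 'X of [G] can be cancelled because [phi] has no zeros; a nonzero constant term is what a
    denominator needs in [div_annihilant]. *)
Lemma algebraic_over_wide0 (W : Type) (m phi : W -> C) :
  algebraic_over m phi -> (forall w, phi w != 0) ->
  exists G : {poly {poly C}},
    [/\ G.[0] != 0, (1 < size G)%N & forall w, G.[phi w, m w] = 0].
Proof.
move=> [G Gn HG] phin.
have [n] := ubnP (size G); elim: n G Gn HG => // n IH G Gn HG szG.
have [G0|G0] := eqVneq G.[0] 0.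
  have /factor_theorem[G1 DG] : root G 0 by apply/rootP.
  rewrite subr0 in DG.
  have G1n : G1 != 0 by apply: contraNneq Gn => G10; rewrite DG G10 mul0r.
  apply: (IH G1) => // [w|]; last by move: szG; rewrite DG size_mulX.
  have := HG w; rewrite DG horner2M hornerX hornerC => /eqP.
  by rewrite mulf_eq0 (negPf (phin w)) orbF => /eqP.
exists (('X - 1) * G); split=> [||w].
- by rewrite hornerM -polyC1 hornerXsubC sub0r mulN1r oppr_eq0.
- rewrite size_mul //; last by rewrite -polyC1 polyXsubC_eq0.
  by rewrite -polyC1 size_XsubC /= ltnS size_poly_gt0.
- by rewrite horner2M HG mulr0.
Qed.

Variables (W : Type) (m : W -> C).
Implicit Types phi psi : W -> C.

Lemma algebraic_over_cst (c : C) : algebraic_over m (fun=> c).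
Proof.
exists ('X - c%:P%:P); first by rewrite polyXsubC_eq0.
by move=> w; rewrite hornerXsubC subrr horner0.
Qed.

Lemma algebraic_over_base : algebraic_over m m.
Proof.
exists ('X - 'Y); first by rewrite polyXsubC_eq0.
by move=> w; rewrite hornerXsubC hornerD hornerN hornerC hornerX subrr.
Qed.

Lemma algebraic_over_sub phi psi :
  algebraic_over m phi -> algebraic_over m psi ->
  algebraic_over m (fun w => phi w - psi w).
Proof.
move=> /algebraic_over_wide[p [pn sp Hp]] /algebraic_over_wide[q [qn sq Hq]].
exists (sub_annihilant p q); first exact: sub_annihilant_neq0.
move=> w; have [uv _ E] := sub_annihilant_in_ideal sp sq.
rewrite (E (psi w)%:P (phi w - psi w)%:P) -polyCD [psi w + _]addrC subrK.
by rewrite hornerD !hornerM Hp Hq !mulr0 addr0.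
Qed.

Lemma algebraic_over_div phi psi :
  algebraic_over m phi -> algebraic_over m psi -> (forall w, psi w != 0) ->
  algebraic_over m (fun w => phi w / psi w).
Proof.
move=> /algebraic_over_wide[p [pn sp Hp]] Hpsi nz.
have [q [qn sq Hq]] := algebraic_over_wide0 Hpsi nz.
exists (div_annihilant p q); first exact: div_annihilant_neq0.
move=> w; have [uv _ E] := div_annihilant_in_ideal sp sq.
rewrite (E (psi w)%:P (phi w / psi w)%:P) -polyCM [psi w * _]mulrC divfK //.
by rewrite hornerD !hornerM Hp Hq !mulr0 addr0.
Qed.

Lemma algebraic_over_add phi psi :
  algebraic_over m phi -> algebraic_over m psi ->
  algebraic_over m (fun w => phi w + psi w).
Proof.
move=> Hphi Hpsi.
have := algebraic_over_sub Hphi (algebraic_over_sub (algebraic_over_cst 0) Hpsi).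
by move=> [G Gn HG]; exists G => // w; rewrite -[RHS](HG w) sub0r opprK.
Qed.
End AlgebraicFunctions.

Section AlgebraicProducts.
Variables (C : closedFieldType) (W : Type) (m : W -> C).
Implicit Types phi psi : W -> C.

(** Where [psi] is nonzero the product is [phi / (1 / psi)]; an extra factor 'X covers the zeros of
    [psi]. *)
Lemma algebraic_over_mul phi psi :
  algebraic_over m phi -> algebraic_over m psi ->
  algebraic_over m (fun w => phi w * psi w).
Proof.
move=> [p pn Hp] [q qn Hq].
pose W' := {w : W | psi w != 0}.
have [G Gn HG] : algebraic_over (fun w : W' => m (sval w))
                   (fun w : W' => phi (sval w) / (1 / psi (sval w))).
  apply: algebraic_over_div; first by exists p => // w; apply: Hp.
    apply: algebraic_over_div; first exact: algebraic_over_cst.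
      by exists q => // w; apply: Hq.
    by case.
  by case=> w /= wn; rewrite div1r invr_eq0.
exists ('X * G); first by rewrite mulf_neq0 // polyX_eq0.
move=> w; rewrite horner2M hornerX hornerC.
have [->|wn] := eqVneq (psi w) 0; first by rewrite mulr0 mul0r.
by have := HG (exist _ w wn); rewrite /= div1r invrK => ->; rewrite mulr0.
Qed.

Lemma algebraic_over_ext phi psi :
  algebraic_over m phi -> phi =1 psi -> algebraic_over m psi.
Proof. by move=> [G Gn HG] E; exists G => // w; rewrite -E. Qed.

End AlgebraicProducts.

(** * Lucas sequences and the tail polynomials *)


Section Lucas.
Variable R : comNzRingType.
Implicit Types (P Q x c : R).

Fixpoint lucas P Q n : R :=
  if n is n1.+1 then
    if n1 is n2.+1 then P * lucas P Q n1 - Q * lucas P Q n2 else 1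
  else 0.

Lemma lucasSS P Q n : lucas P Q n.+2 = P * lucas P Q n.+1 - Q * lucas P Q n.
Proof. by []. Qed.

(** Homogeneity, with an extra factor [c] so that n = 0 is no exception. It clears denominators when
    x is given as a quotient. *)
Lemma lucas_scale P Q c n : c * lucas (c * P) (c ^+ 2 * Q) n = c ^+ n * lucas P Q n.
Proof.
elim/nat_ind2: n => [||n IH0 IH1]; first by rewrite !mulr0.
  by rewrite !mulr1.
rewrite !lucasSS mulrBr; have -> : c * (c * P * lucas (c * P) (c ^+ 2 * Q) n.+1) =
  c * P * (c * lucas (c * P) (c ^+ 2 * Q) n.+1) by ring.
have -> : c * (c ^+ 2 * Q * lucas (c * P) (c ^+ 2 * Q) n) =
  c ^+ 2 * Q * (c * lucas (c * P) (c ^+ 2 * Q) n) by ring.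
rewrite IH0 IH1 !exprS; ring.
Qed.

(** The bracket [n]_x, that is, the Chebyshev polynomial of the second kind U_(n-1)(x/2). *)
Definition cheb x n := lucas x 1 n.

Lemma chebSS x n : cheb x n.+2 = x * cheb x n.+1 - cheb x n.
Proof. by rewrite /cheb lucasSS mul1r. Qed.

Lemma cheb_cassini x n :
  cheb x n.+1 ^+ 2 + cheb x n ^+ 2 - x * cheb x n.+1 * cheb x n = 1.
Proof.
elim: n => [|n IH]; first by rewrite /cheb /=; ring.
by rewrite -[RHS]IH chebSS; ring.
Qed.

(** The parabolic value x = -2 is the test point at which [trace_eq] and [degen_poly] are seen to be
    nonzero. *)
Lemma cheb_m2 n : cheb (- 2%:R) n = - ((- 1) ^+ n * n%:R).
Proof.
elim/nat_ind2: n => [||n IH0 IH1].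
- by rewrite mulr0 oppr0.
- by rewrite expr1 mulr1 opprK.
- by rewrite chebSS IH0 IH1 !exprS -[n.+2]addn2 -[n.+1]addn1 !natrD; ring.
Qed.

End Lucas.

Lemma rmorph_lucas (R S : comNzRingType) (f : {rmorphism R -> S}) (P Q : R) n :
  f (lucas P Q n) = lucas (f P) (f Q) n.
Proof.
elim/nat_ind2: n => [||n IH0 IH1]; rewrite ?rmorph0 ?rmorph1 //.
by rewrite !lucasSS rmorphB !rmorphM IH0 IH1.
Qed.

Section TailPolynomial.
Variable R : comNzRingType.

Definition tail_coef n a b := ('C(n.-1 - a, b) * 'C(n - b, a))%N.

Lemma tail_coef_small n a b : (n < a + b)%N -> tail_coef n a b = 0%N.
Proof.
rewrite /tail_coef => ltnab; case: b ltnab => [|b] ltnab.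
  by rewrite [X in (_ * X)%N]bin_small ?muln0 // subn0 -[a]addn0.
by rewrite bin_small ?mul0n //; lia.
Qed.

(** The coefficients of [tail_poly_rec], with the subtracted term moved to the left. Pascal's rule
    for both binomials gives the main range; the other cases are those where a subtraction is
    truncated. *)
Lemma tail_coef_rec n a b :
  (tail_coef n.+2 a b + (if a is a'.+1 then if b is b'.+1 then tail_coef n a' b'
                         else 0 else 0) =
   (if a is a'.+1 then tail_coef n.+1 a' b else 0) +
   (if b is b'.+1 then tail_coef n.+1 a b' else 0) + tail_coef n.+1 a b)%N.
Proof.
rewrite /tail_coef /=; case: a => [|a]; case: b => [|b].
- by rewrite !bin0.
- by rewrite !bin0 !subn0 !muln1 binS; lia.
- by rewrite !bin0 !subn0 !mul1n binS; lia.
have [lan|lna] := ltnP a n; last first.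
  have -> : (n.+1 - a.+1 = 0)%N by lia.
  have -> : (n.-1 - a = 0)%N by lia.
  have -> : (n - a.+1 = 0)%N by lia.
  have -> : (n - a = 0)%N by lia.
  case: b => [|b]; last by rewrite !bin0n !mul0n.
  rewrite !subn0 !bin0n /= !mul0n !mul1n add0n addn0.
  have [-> | an] := eqVneq a n; first by rewrite !binn.
  by rewrite !bin_small //; lia.
have [lnb|lbn] := ltnP n b.
  have -> : (n.+2 - b.+1 = 0)%N by lia.
  have -> : (n - b = 0)%N by lia.
  have -> : (n.+1 - b.+1 = 0)%N by lia.
  have -> : (n.+1 - b = 0)%N by lia.
  rewrite !bin0n /= !muln0 !addn0 !add0n; case: a lan => [|a] lan; last by rewrite !muln0.
  by rewrite !muln1 !bin_small //; lia.
have -> : (n.+1 - a.+1 = (n.-1 - a).+1)%N by lia.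
have -> : (n - a = (n.-1 - a).+1)%N by lia.
have -> : (n.+2 - b.+1 = (n - b).+1)%N by lia.
have -> : (n.+1 - b = (n - b).+1)%N by lia.
have -> : (n - a.+1 = n.-1 - a)%N by lia.
rewrite subSS !binS; nia.
Qed.

(* H_n = (- P^2)^n (tail_poly n).[- O_1^2 / P^2, - O_0^2 / P^2]: dividing by - P^2 absorbs the
   signs, and the summands of tail_poly with n < a + b vanish. *)
Definition tail_poly n : {poly {poly R}} :=
  \poly_(a < n.+1) \poly_(b < n.+1) (tail_coef n a b)%:R.

Lemma coef_tail_poly n a b : (tail_poly n)`_a`_b = (tail_coef n a b)%:R.
Proof.
rewrite coef_poly; case: ltnP => [_|lna].
  rewrite coef_poly; case: ltnP => // lnb.
  by rewrite tail_coef_small //; lia.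
by rewrite coef0 tail_coef_small //; lia.
Qed.

Lemma tail_poly_rec n : tail_poly n.+2 =
  ('X + 'Y + 1) * tail_poly n.+1 - 'X * 'Y * tail_poly n.
Proof.
apply/eqP; rewrite eq_sym subr_eq eq_sym; apply/eqP.
apply/polyP => a; apply/polyP => b.
rewrite !mulrDl mul1r -mulrA !coefD !coefXM !coefCM !coefXM.
have := tail_coef_rec n a b.
by case: a => [|a]; case: b => [|b] /=; rewrite ?coefXM /= ?coef0 !coef_tail_poly;
  rewrite ?addr0 ?add0r -?natrD => E; apply: (congr1 (fun k => k%:R : R)); lia.
Qed.
End TailPolynomial.

Section Tails.
Variable C : fieldType.
Implicit Types (gamma : edge -> C) (i : tail).

Lemma H_tail_poly gamma i n : gamma (EP i) != 0 ->
  let z := - gamma (EP i) ^+ 2 in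
  H gamma i n =
  z ^+ n * (tail_poly C n).[gamma (EO1 i) ^+ 2 / z, gamma (EO0 i) ^+ 2 / z].
Proof.
move=> Pn z; have zn : z != 0 by rewrite oppr_eq0 expf_neq0.
set x := gamma (EO1 i) ^+ 2; set y := gamma (EO0 i) ^+ 2.
rewrite horner2E /tail_poly.
have -> : map_poly (horner_eval (y / z)) (\poly_(a < n.+1) \poly_(b < n.+1) (tail_coef n a b)%:R)
  = \poly_(a < n.+1) \sum_(b < n.+1) (tail_coef n a b)%:R * (y / z) ^+ b.
  apply/polyP => a; rewrite coef_map !coef_poly /horner_eval.
  by case: (a < n.+1)%N; rewrite /= /horner_eval ?horner_poly ?horner0.
(* The row a = n has its only nonzero coefficient at b = 0 and gives the separate leading power of
   [H]. *)
rewrite horner_poly big_ord_recr /= mulrDr addrC /H; congr (_ + _).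
  rewrite big_ord_recl /= big1 => [|b _]; last first.
    by rewrite tail_coef_small ?mul0r //= /bump; lia.
  rewrite addr0 /tail_coef bin0 subn0 binn mul1n expr0 mulr1 mul1r.
  by rewrite expr_div_n mulrCA divff ?mulr1 ?expf_neq0 // /x -exprM.
rewrite mulr_sumr; apply: eq_bigr => a _.
rewrite big_ord_recr /=.
have -> : tail_coef n a n = 0%N.
  rewrite /tail_coef subnn bin0n; case: a => [[|a] lan]; last by rewrite muln0.
  by rewrite bin_small //; lia.
rewrite mul0r addr0 mulr_suml mulr_sumr big_mkcond; apply: eq_bigr => b _.
case: leqP => lab; last first.
  have -> : tail_coef n a b = 0%N.
    by rewrite /tail_coef bin_small ?mul0n //; have := ltn_ord a; have := ltn_ord b; lia.
  by rewrite !mul0r mulr0.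
have -> : z ^+ n = z ^+ a * z ^+ b * z ^+ (n - a - b).
  by rewrite -!exprD; congr (_ ^+ _); have := ltn_ord a; have := ltn_ord b; lia.
rewrite [z ^+ (_ - _)]exprNn !expr_div_n -/x -/y /tail_coef natrM !exprM -/x -/y.
have := expf_neq0 a zn; have := expf_neq0 b zn.
by move=> za zb; field; rewrite za zb.
Qed.

Lemma H_rec gamma i n : gamma (EP i) != 0 ->
  H gamma i n.+2 =
  (gamma (EO1 i) ^+ 2 + gamma (EO0 i) ^+ 2 - gamma (EP i) ^+ 2) * H gamma i n.+1
  - gamma (EO1 i) ^+ 2 * gamma (EO0 i) ^+ 2 * H gamma i n.
Proof.
move=> Pn; rewrite !H_tail_poly // tail_poly_rec.
have : - gamma (EP i) ^+ 2 != 0 by rewrite oppr_eq0 expf_neq0.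
move: (- gamma (EP i) ^+ 2) (gamma (EO1 i) ^+ 2) (gamma (EO0 i) ^+ 2) => z x y zn.
rewrite !(exprS z) !(hornerD, hornerN, hornerM, hornerX, hornerC).
set T1 := (tail_poly C n.+1).[_].[_]; set T0 := (tail_poly C n).[_].[_].
by field.
Qed.

Lemma H0 gamma i : H gamma i 0 = 1.
Proof. by rewrite /H muln0 expr0 big_ord0 addr0. Qed.

Lemma H1 gamma i : H gamma i 1 = gamma (EO1 i) ^+ 2 - gamma (EP i) ^+ 2.
Proof.
rewrite /H big_ord_recl big_ord0 big_mkcond big_ord_recl big_ord0 /=.
by rewrite !subn0 bin0 bin0 muln0 expr0 !muln1; ring.
Qed.

Lemma H_lucas gamma i n (x := (gamma (EO0 i) ^+ 2 + gamma (EO1 i) ^+ 2 -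
    gamma (EP i) ^+ 2) / (gamma (EO0 i) * gamma (EO1 i))) :
  (forall e, gamma e != 0) ->
  gamma (EO1 i) * H gamma i n = (gamma (EO0 i) * gamma (EO1 i)) ^+ n *
    (gamma (EO1 i) * cheb x n.+1 - gamma (EO0 i) * cheb x n).
Proof.
move=> gn; have := gn (EP i); have := gn (EO0 i); have := gn (EO1 i).
elim/nat_ind2: n => [||n IH0 IH1] bn an Pn.
- by rewrite H0 /cheb /= expr0; ring.
- by rewrite H1 chebSS /cheb /= /x expr1; field; rewrite an bn.
rewrite H_rec // mulrBr mulrCA IH1 // [X in _ - X]mulrCA IH0 // !chebSS !exprS /x.
by field; rewrite an bn.
Qed.

End Tails.


(** * Tail equations and Chebyshev values *)

Section TailSolutions.
Variable C : fieldType.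
Implicit Types (gamma : edge -> C) (i : tail).

Definition tail_trace gamma i : C :=
  (gamma (EO0 i) ^+ 2 + gamma (EO1 i) ^+ 2 - gamma (EP i) ^+ 2) /
    (gamma (EO0 i) * gamma (EO1 i)).

(* With O_n = O_1 [n]_x - O_0 [n-1]_x, the tail equation is O_(r-1) = P, and the invariant
   O_n^2 + O_(n+1)^2 - x O_n O_(n+1) = P^2 then gives O_(r-2) = x P, as O_(r-2) <> 0. *)
Lemma tail_cheb gamma i r (x := tail_trace gamma i) : (3 <= r)%N ->
  (forall e, gamma e != 0) -> inner_edges_nonzero gamma i r ->
  tail_equation gamma i r = 0 ->
  gamma (EO0 i) = gamma (EP i) * cheb x r /\
  gamma (EO1 i) = gamma (EP i) * cheb x r.-1.
Proof.
move=> r3 gn inner /eqP; rewrite subr_eq0 => /eqP tailE.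
have := gn (EO0 i); have := gn (EO1 i); have := gn (EP i).
have HE n : gamma (EO1 i) * H gamma i n =
    (gamma (EO0 i) * gamma (EO1 i)) ^+ n *
    (gamma (EO1 i) * cheb x n.+1 - gamma (EO0 i) * cheb x n) by exact: H_lucas.
have xE : x * (gamma (EO0 i) * gamma (EO1 i)) =
    gamma (EO0 i) ^+ 2 + gamma (EO1 i) ^+ 2 - gamma (EP i) ^+ 2.
  by rewrite /x /tail_trace divfK // mulf_neq0.
move: (gamma (EO0 i)) (gamma (EO1 i)) (gamma (EP i)) HE xE tailE => a b P HE xE tailE Pn bn an.
pose o n := if n is n'.+1 then b * cheb x n'.+1 - a * cheb x n' else a.
have oSS n : o n.+2 = x * o n.+1 - o n.
  case: n => [|n] /=; first by rewrite chebSS /cheb /=; ring.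
  by rewrite !chebSS; ring.
have o_inv n : o n.+1 ^+ 2 + o n ^+ 2 - x * o n.+1 * o n = P ^+ 2.
  elim: n => [|n IH]; last by rewrite -IH oSS; ring.
  apply: (@eqr_comb0 _ _ _ (a ^+ 2 + b ^+ 2 - P ^+ 2 - x * (a * b))).
    by rewrite /o /cheb /=; ring.
  by rewrite xE subrr.
have abn k : (a * b) ^+ k != 0 by rewrite expf_neq0 // mulf_neq0.
have o_last : o r.-1 = P.
  case: r r3 inner tailE => [|[|[|k]]] // _ _; rewrite !subSS !subn0 => tailE.
  apply: (mulfI (abn k.+1)); rewrite [o _]/= -HE tailE exprMn [b ^+ _.+1]exprS.
  by ring.
have o_penult : o (r - 2)%N = P * x.
  have on : o (r - 2)%N != 0.
    case: r r3 inner {tailE o_last} => [|[|[|[|k]]]] // _ inner.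
      by rewrite /= /cheb /= mulr1 mulr0 subr0.
    have /eqP hn : H gamma i k.+1 <> 0 by apply: inner; rewrite !subSS subn0 ltnS leqnn.
    have : b * H gamma i k.+1 != 0 by rewrite mulf_neq0.
    by rewrite HE mulf_eq0 negb_or !subSS subn0 => /andP[].
  have := o_inv (r - 2)%N; have -> : ((r - 2).+1 = r.-1)%N by lia.
  rewrite o_last => E; apply: (mulfI on).
  apply: (@eqr_comb0 _ _ _ (P ^+ 2 + o (r - 2)%N ^+ 2 - x * P * o (r - 2)%N - P ^+ 2)).
    by ring.
  by rewrite E subrr.
(* Read backwards from P and x P, the recursion is again the Chebyshev recursion; it reaches O_1 at
   k = r - 2 and O_0 at k = r - 1. *)
have back k : (k < r)%N -> o (r - k.+1)%N = P * cheb x k.+1.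
  elim/nat_ind2: k => [||k IH0 IH1] kr.
  - by rewrite subn1 o_last /cheb /= mulr1.
  - by rewrite o_penult chebSS /cheb /= mulr1 subr0.
  have := oSS (r - k.+3)%N.
  have -> : ((r - k.+3).+2 = r - k.+1)%N by lia.
  have -> : ((r - k.+3).+1 = r - k.+2)%N by lia.
  rewrite IH0 ?IH1; [|lia|lia] => E.
  by rewrite chebSS mulrBr E; ring.
split.
  have lr : (r.-1 < r)%N by lia.
  have := back _ lr; have -> : (r.-1.+1 = r)%N by lia.
  by rewrite subnn.
have lr : (r.-2 < r)%N by lia.
have := back _ lr; have -> : (r.-2.+1 = r.-1)%N by lia.
have -> : (r - r.-1 = 1)%N by lia.
by rewrite /= /cheb /= mulr1 mulr0 subr0.
Qed.

(** The converse of [tail_cheb]: the variable of O_(n+1) is P [r-n-1]_x. For the inner edges the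
    index is at least 2, and for n = r - 2 the value is P, which is the tail equation. *)
Lemma cheb_tail gamma i r x : (3 <= r)%N ->
  (forall e, gamma e != 0) -> (forall k, (1 < k <= r)%N -> cheb x k != 0) ->
  gamma (EO0 i) = gamma (EP i) * cheb x r ->
  gamma (EO1 i) = gamma (EP i) * cheb x r.-1 ->
  inner_edges_nonzero gamma i r /\ tail_equation gamma i r = 0.
Proof.
move=> r3 gn xn Ea Eb.
have := gn (EO0 i); have := gn (EO1 i); have := gn (EP i).
set a := gamma (EO0 i) in Ea *; set b := gamma (EO1 i) in Eb *.
set P := gamma (EP i) in Ea Eb * => Pn bn an.
have xE : x = tail_trace gamma i.
  rewrite /tail_trace -/a -/b -/P; apply: (mulIf (mulf_neq0 an bn)).
  rewrite divfK ?mulf_neq0 // Ea Eb.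
  have := cheb_cassini x r.-1; have -> : (r.-1.+1 = r)%N by lia.
  move=> cas; apply: (@eqr_comb0 _ _ _
    (P ^+ 2 * (1 - (cheb x r ^+ 2 + cheb x r.-1 ^+ 2 - x * cheb x r * cheb x r.-1)))).
    by ring.
  by rewrite cas subrr mulr0.
have HE n : b * H gamma i n = (a * b) ^+ n * (b * cheb x n.+1 - a * cheb x n).
  by rewrite xE; apply: H_lucas.
have o_back n : (n < r)%N -> b * cheb x n.+1 - a * cheb x n = P * cheb x (r - n.+1).
  elim/nat_ind2: n => [||n IH0 IH1] nr.
  - by rewrite /cheb /= mulr1 mulr0 subr0 Eb subn1.
  - rewrite chebSS /cheb /= mulr1 -/(cheb x _) Eb Ea.
    have [r' ->] : exists r', r = r'.+2 by exists (r - 2)%N; lia.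
    by rewrite /= -/(cheb x _) !subSS subn0 (chebSS x r') /=; ring.
  have e0 : (r - n.+1 = (r - n.+3).+2)%N by lia.
  have e1 : (r - n.+2 = (r - n.+3).+1)%N by lia.
  rewrite e0 chebSS in IH0; rewrite e1 in IH1.
  have -> : P * cheb x (r - n.+3) =
      x * (P * cheb x (r - n.+3).+1) -
      P * (x * cheb x (r - n.+3).+1 - cheb x (r - n.+3)) by ring.
  rewrite -IH0 -?IH1 ?chebSS; [by ring|lia|lia].
split=> [n nr|].
  have : b * H gamma i n != 0.
    rewrite HE o_back; last lia.
    by rewrite mulf_neq0 ?expf_neq0 ?mulf_neq0 ?xn //; lia.
  by rewrite mulf_eq0 negb_or => /andP[_ /eqP].
rewrite /tail_equation; apply/eqP; rewrite subr_eq0; apply/eqP.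
apply: (mulfI bn); rewrite HE o_back; last lia.
have -> : (r - (r - 2).+1 = 1)%N by lia.
rewrite /cheb /= mulr1 exprMn -/a -/b -/P.
have -> : (r - 2 = (r - 3).+1)%N by lia.
by rewrite [b ^+ _.+1]exprS; ring.
Qed.

End TailSolutions.

(** * The gluing curve *)


Section GluingIdentities.
Variable C : fieldType.

(* The gluing equations in the variables of the file header; the last two conditions are that
   gamma_E0 and gamma_E1 are nonzero. *)
Definition glued (m x y A A' B B' : C) : Prop :=
  [/\ A + A' + (y + m + m^-1) * A * B * (B + B') = 0,
      (x + m + m^-1) * (y + m + m^-1) * A ^+ 2 * B ^+ 2 = 1,
      m * A + A' != 0 /\ A + m * A' != 0
    & m * B + B' != 0 /\ B + m * B' != 0].

Variables (m x y A A' B B' : C).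
Hypothesis m0 : m != 0.
Hypothesis cA : A ^+ 2 + A' ^+ 2 - x * A * A' = 1.
Hypothesis cB : B ^+ 2 + B' ^+ 2 - y * B * B' = 1.

Let mV : m * m^-1 = 1. Proof. exact: mulfV. Qed.

(** Up to nonzero multiples the two factors are gamma_E0 and gamma_E1, for either tail. *)
Lemma mul_holonomy_factors z D D' : D ^+ 2 + D' ^+ 2 - z * D * D' = 1 ->
  (m * D + D') * (D + m * D') = m * (1 + (z + m + m^-1) * D * D').
Proof.
move=> cD; apply: (@eqr_comb0 _ _ _ (m * (D ^+ 2 + D' ^+ 2 - z * D * D' - 1) +
  (1 - m * m^-1) * D * D')); first by ring.
by rewrite cD mV !subrr mulr0 !mul0r addr0.
Qed.

Section Glued.
Hypothesis G : glued m x y A A' B B'.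
Let W := x + m + m^-1.
Let V := y + m + m^-1.

Lemma glued_nz : [/\ A != 0, B != 0, W != 0 & V != 0].
Proof.
case: G => _; rewrite -/W -/V => WV _ _.
have : W * V * A ^+ 2 * B ^+ 2 != 0 by rewrite WV oner_eq0.
by rewrite !mulf_eq0 !orbb !negb_or => /andP[/andP[/andP[-> ->] ->] ->].
Qed.

Lemma glued_swap_eq : B + B' + W * B * A * (A + A') = 0.
Proof.
case: G; rewrite -/W -/V => E WV _ _.
apply: (@eqr_comb0 _ _ _ (W * B * A * (A + A' + V * A * B * (B + B'))
  + (1 - W * V * A ^+ 2 * B ^+ 2) * (B + B'))); first by ring.
by rewrite E WV mulr0 subrr mul0r addr0.
Qed.

Lemma glued_swap : glued m y x B B' A A'.
Proof.
case: G => E WV nA nB; split => //; first exact: glued_swap_eq.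
by rewrite -[RHS]WV; ring.
Qed.

Lemma glued_rel4 : 1 + W * A * A' = - W * A ^+ 2 * (1 + V * B * B').
Proof.
case: G; rewrite -/W -/V => E WV _ _.
apply: (@eqr_comb0 _ _ _ (W * A * (A + A' + V * A * B * (B + B'))
  + (1 - W * V * A ^+ 2 * B ^+ 2))); first by ring.
by rewrite E WV mulr0 subrr addr0.
Qed.

Lemma glued_rel4_swap : 1 + V * B * B' = - V * B ^+ 2 * (1 + W * A * A').
Proof.
case: G; rewrite -/W -/V => _ WV _ _.
apply: (@eqr_comb0 _ _ _ (V * B * (B + B' + W * B * A * (A + A'))
  + (1 - W * V * A ^+ 2 * B ^+ 2))); first by ring.
by rewrite glued_swap_eq WV mulr0 subrr addr0.
Qed.

(** Makes - y the trace of A2 A1^-1 in the representation. The gluing equations give W (A + A')^2 =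
    V (B + B')^2; expanding the squares by the Cassini identities and applying [glued_rel4] leaves a
    common factor, which is nonzero. *)
Lemma glued_traceB : y + 2%:R = - (x + 2%:R) * W * A ^+ 2.
Proof.
case: (G); rewrite -/W -/V => E WV [nA nA'] [nB nB'].
have nVB : 1 + V * B * B' != 0.
  have : (m * B + B') * (B + m * B') != 0 by rewrite mulf_neq0.
  by rewrite (mul_holonomy_factors cB) mulf_eq0 negb_or => /andP[_].
have sqA : (A + A') ^+ 2 = 1 + (x + 2%:R) * A * A'.
  by apply: (@eqr_comb0 _ _ _ (A ^+ 2 + A' ^+ 2 - x * A * A' - 1)); [ring|rewrite cA subrr].
have sqB : (B + B') ^+ 2 = 1 + (y + 2%:R) * B * B'.
  by apply: (@eqr_comb0 _ _ _ (B ^+ 2 + B' ^+ 2 - y * B * B' - 1)); [ring|rewrite cB subrr].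
have E1 : W * (A + A') ^+ 2 = V * (B + B') ^+ 2.
  have -> : A + A' = - (V * A * B * (B + B')).
    by apply/eqP; rewrite -addr_eq0 E.
  by rewrite -[RHS]mul1r -WV; ring.
have E2 : (x + 2%:R) * (1 + W * A * A') = (y + 2%:R) * (1 + V * B * B').
  apply: (@eqr_comb0 _ _ _ (W * (A + A') ^+ 2 - V * (B + B') ^+ 2)).
    by rewrite sqA sqB /W /V; ring.
  by rewrite E1 subrr.
by apply: (mulIf nVB); rewrite -E2 glued_rel4; ring.
Qed.

(** Identifies the longitude eigenvalue with [glued_root], denominators cleared. With T = m W A F,
    both sides equal B (m - 1 + T) (m (m - 1) - T). *)
Lemma glued_longitude :
  let F := A + A' in let z := x + 2%:R in
  (z * m * A - (m - 1) * F) * (A + m * A') * (B + m * B') =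
  (z * A + (m - 1) * F) * m * (m * A + A') * (m * B + B').
Proof.
move=> F z; have EB := glued_swap_eq.
have -> : B' = - B * (1 + W * A * F).
  apply: (@eqr_comb0 _ _ _ (B + B' + W * B * A * (A + A'))) => //.
  by rewrite /F; ring.
have sqA : F ^+ 2 = 1 + z * A * A'.
  by apply: (@eqr_comb0 _ _ _ (A ^+ 2 + A' ^+ 2 - x * A * A' - 1));
    [rewrite /F /z; ring|rewrite cA subrr].
pose T := m * W * A * F.
have mW : m * W = m * z + (m - 1) ^+ 2.
  apply: (@eqr_comb0 _ _ _ (m * m^-1 - 1)); first by rewrite /W /z; ring.
  by rewrite mV subrr.
have E1 : (z * A + (m - 1) * F) * (m * A + A') = m - 1 + T.
  apply: (@eqr_comb0 _ _ _ ((m - 1) * (F ^+ 2 - (1 + z * A * A')))).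
    by rewrite /T mW /F; ring.
  by rewrite sqA subrr mulr0.
have E2 : (z * m * A - (m - 1) * F) * (A + m * A') = T - (m - 1) * m.
  apply: (@eqr_comb0 _ _ _ (- (m - 1) * m * (F ^+ 2 - (1 + z * A * A')))).
    by rewrite /T mW /F; ring.
  by rewrite sqA subrr mulr0.
have -> : (z * A + (m - 1) * F) * m * (m * A + A') =
  m * ((z * A + (m - 1) * F) * (m * A + A')) by ring.
by rewrite E1 E2 /T; ring.
Qed.

End Glued.

(* The value of s = l^{1/2}. *)
Definition glued_root (m A A' B B' : C) : C :=
  ((A + m * A') * (B + m * B')) / (m * (m * A + A') * (m * B + B')).

Section Forward.
Variables (P Q e0 e1 s : C).
Hypothesis nz : [/\ P != 0, Q != 0, e0 != 0, e1 != 0 & s != 0].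
Hypothesis nzA : [/\ A != 0, A' != 0, B != 0 & B' != 0].

Let a := P * A. Let b := P * A'. Let c := Q * B. Let d := Q * B'.

(** The equations of Delta_1, Delta_2, Delta_4 and Delta_5 express [e0] and [e1] twice each;
    comparison gives [s]. Delta_0 gives [Q ^+ 2] in terms of [P ^+ 2], Delta_3 then the first gluing
    equation, and the two values of [e0 * e1] the second. *)
Lemma glued_of_gluing :
  - (m * c * d) + s^-1 * a ^+ 2 - e0 * e1 = 0 ->
  m * a * c + a * d - e1 * Q = 0 ->
  s^-1 * m^-1 * a * c + s^-1 * a * d - e0 * Q = 0 ->
  m^-1 * e0 * e1 + s^-1 * m^-1 * a * b - c ^+ 2 = 0 ->
  a * c + m * b * c - e1 * P = 0 ->
  m * a * c + b * c - e0 * P = 0 ->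
  glued m x y A A' B B' /\ s = glued_root m A A' B B'.
Proof.
case: nz nzA => Pn Qn e0n e1n sn [An A'n Bn B'n].
set W := x + m + m^-1; set V := y + m + m^-1.
set t := s^-1; have tn : t != 0 by rewrite invr_eq0.
move=> D0 D1 D2 D3 D4 D5.
have F1 : e1 = P * A * (m * B + B').
  apply: (mulIf Qn); apply/esym; apply: (@eqr_comb0 _ _ _ _ _ D1).
  by rewrite /a /c /d; ring.
have F0 : m * e0 = t * P * A * (B + m * B').
  apply: (mulIf Qn); apply/esym.
  apply: (@eqr_comb0 _ _ _ (m * (t * m^-1 * a * c + t * a * d - e0 * Q)
     + (1 - m * m^-1) * t * a * c)); first by rewrite /a /c /d; ring.
  by rewrite D2 mV mulr0 subrr !mul0r addr0.
have G1 : e1 = Q * B * (A + m * A').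
  apply: (mulIf Pn); apply/esym; apply: (@eqr_comb0 _ _ _ _ _ D4).
  by rewrite /a /b /c; ring.
have G0 : e0 = Q * B * (m * A + A').
  apply: (mulIf Pn); apply/esym; apply: (@eqr_comb0 _ _ _ _ _ D5).
  by rewrite /a /b /c; ring.
have nB1 : m * B + B' != 0 by move: e1n; rewrite F1 mulf_eq0 negb_or => /andP[].
have nA1 : A + m * A' != 0 by move: e1n; rewrite G1 mulf_eq0 negb_or => /andP[].
have nA2 : m * A + A' != 0 by move: e0n; rewrite G0 mulf_eq0 negb_or => /andP[].
have nB2 : B + m * B' != 0.
  have : m * e0 != 0 by rewrite mulf_neq0.
  by rewrite F0 mulf_eq0 negb_or => /andP[].
have hA := mul_holonomy_factors cA; have hB := mul_holonomy_factors cB.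
rewrite -/W in hA; rewrite -/V in hB.
have e01 : e0 * e1 = t * P ^+ 2 * A ^+ 2 * (1 + V * B * B').
  apply: (mulfI m0); rewrite mulrA F0 F1.
  transitivity (t * P ^+ 2 * A ^+ 2 * ((m * B + B') * (B + m * B'))); first by ring.
  by rewrite hB; ring.
have e01' : e0 * e1 = m * Q ^+ 2 * B ^+ 2 * (1 + W * A * A').
  rewrite G0 G1.
  transitivity (Q ^+ 2 * B ^+ 2 * ((m * A + A') * (A + m * A'))); first by ring.
  by rewrite hA; ring.
have Q2 : m * Q ^+ 2 = - (t * P ^+ 2 * A ^+ 2 * V).
  apply: (mulIf (mulf_neq0 Bn B'n)).
  apply: (@eqr_comb0 _ _ _ (- (- (m * c * d) + t * a ^+ 2 - e0 * e1))).
    by rewrite e01 /a /c /d; ring.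
  by rewrite D0 oppr0.
have tPA : t * P ^+ 2 * A != 0 by rewrite !mulf_neq0.
have III : A + A' + V * A * B * (B + B') = 0.
  apply: (mulfI tPA); rewrite mulr0.
  transitivity (m * (m^-1 * e0 * e1 + t * m^-1 * a * b - c ^+ 2)); last first.
    by rewrite D3 mulr0.
  apply: (@eqr_comb0 _ _ _ ((1 - m * m^-1) * (e0 * e1 + t * a * b) +
     (m * Q ^+ 2 + t * P ^+ 2 * A ^+ 2 * V) * B ^+ 2 -
     (e0 * e1 - t * P ^+ 2 * A ^+ 2 * (1 + V * B * B')))).
    by rewrite /a /b /c; ring.
  by rewrite mV Q2 e01 addNr !subrr !mul0r !addr0 subr0.
split; last first.
  have EPQ : Q * B * (A + m * A') = P * A * (m * B + B') by rewrite -G1.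
  rewrite /glued_root; apply: (can_inj invrK); rewrite -/t invf_div.
  apply: (mulIf (mulf_neq0 nA1 nB2)); rewrite divfK ?mulf_neq0 //.
  apply: (mulfI (mulf_neq0 Pn An)).
  transitivity (m * (Q * B * (A + m * A')) * (m * A + A')); last by rewrite EPQ; ring.
  transitivity (m * e0 * (A + m * A')); first by rewrite F0; ring.
  by rewrite G0; ring.
split=> //.
have IVa : - V * B ^+ 2 * (1 + W * A * A') = 1 + V * B * B'.
  apply: (mulfI (mulf_neq0 tPA An)).
  transitivity (e0 * e1); last by rewrite e01; ring.
  by rewrite e01' Q2; ring.
apply: (mulIf A'n).
apply: (@eqr_comb0 _ _ _ (A * (1 + V * B * B' - (- V * B ^+ 2 * (1 + W * A * A')))
   - (A + A' + V * A * B * (B + B')))); first by rewrite -/W -/V; ring.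
by rewrite III IVa subrr mulr0 subr0.
Qed.
End Forward.

(** [P] stays free by homogeneity. [Q] makes the two expressions for [e1] agree, and [s] those for
    [e0]. *)
Lemma gluing_of_glued (P : C) (G : glued m x y A A' B B')
   (s := glued_root m A A' B B')
   (Q := P * (A * (m * B + B') / (B * (A + m * A'))))
   (e1 := P * A * (m * B + B')) (e0 := Q * B * (m * A + A'))
   (a := P * A) (b := P * A') (c := Q * B) (d := Q * B') :
  [/\ - (m * c * d) + s^-1 * a ^+ 2 - e0 * e1 = 0,
  m * a * c + a * d - e1 * Q = 0,
  s^-1 * m^-1 * a * c + s^-1 * a * d - e0 * Q = 0 &
  [/\ m^-1 * e0 * e1 + s^-1 * m^-1 * a * b - c ^+ 2 = 0,
  a * c + m * b * c - e1 * P = 0 &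
  m * a * c + b * c - e0 * P = 0]].
Proof.
have [An Bn Wn Vn] := glued_nz G.
have [III IV [nA2 nA1] [nB1 nB2]] := G.
set W := x + m + m^-1 in IV Wn *; set V := y + m + m^-1 in III IV Vn *.
set t := s^-1.
have hA := mul_holonomy_factors cA; have hB := mul_holonomy_factors cB.
rewrite -/W in hA; rewrite -/V in hB.
have EQ : Q * (B * (A + m * A')) = P * (A * (m * B + B')).
  by rewrite /Q -mulrA divfK // mulf_neq0.
have Et : t * ((A + m * A') * (B + m * B')) = m * (m * A + A') * (m * B + B').
  by rewrite /t /s /glued_root invf_div divfK // mulf_neq0.
have Et2 : t * P * A * (B + m * B') = m * e0.
  apply: (mulIf nA1); transitivity (P * A * (t * ((A + m * A') * (B + m * B')))).
    by ring.
  rewrite Et /e0.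
  transitivity (m * (m * A + A') * (Q * (B * (A + m * A')))); last by ring.
  by rewrite EQ; ring.
have e01 : e0 * e1 = t * P ^+ 2 * A ^+ 2 * (1 + V * B * B').
  apply: (mulfI m0); rewrite mulrA -Et2 /e1.
  transitivity (t * P ^+ 2 * A ^+ 2 * ((m * B + B') * (B + m * B'))); first by ring.
  by rewrite hB; ring.
have Q2 : m * Q ^+ 2 = - (t * P ^+ 2 * A ^+ 2 * V).
  have n1 : B ^+ 2 * (A + m * A') * (m * A + A') != 0.
    by rewrite !mulf_neq0.
  apply: (mulIf n1).
  transitivity (m * (Q * B * (m * A + A')) * (Q * (B * (A + m * A')))); first by ring.
  rewrite EQ -/e0.
  transitivity (m * (e0 * e1)); first by rewrite /e1; ring.
  rewrite e01.
  have -> : 1 + V * B * B' = - V * B ^+ 2 * (1 + W * A * A').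
    exact: glued_rel4_swap.
  transitivity (- (t * P ^+ 2 * A ^+ 2 * V) * B ^+ 2 * (m * (1 + W * A * A'))).
    by ring.
  by rewrite -hA; ring.
have mn : m^-1 != 0 by rewrite invr_eq0.
split=> //; last split=> //.
- rewrite e01 /a /c /d.
  transitivity (- (m * Q ^+ 2) * B * B' - t * P ^+ 2 * A ^+ 2 * V * B * B').
    by ring.
  by rewrite Q2; ring.
- by rewrite /a /c /d /e1; ring.
- apply: (mulfI m0); rewrite mulr0.
  transitivity ((m * m^-1 - 1) * t * a * c + Q * (t * P * A * (B + m * B') - m * e0)).
    by rewrite /a /c /d; ring.
  by rewrite mV Et2 !subrr mulr0 !mul0r addr0.
- apply: (mulfI m0); rewrite mulr0.
  transitivity ((m * m^-1 - 1) * (e0 * e1 + t * a * b) + e0 * e1 + t * a * b - m * Q ^+ 2 * B ^+ 2).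
    by rewrite /c; ring.
  rewrite mV subrr mul0r add0r Q2 e01 /a /b.
  transitivity (t * P ^+ 2 * A * (A + A' + V * A * B * (B + B'))); first by ring.
  by rewrite III mulr0.
- transitivity (P * (Q * (B * (A + m * A')) - e1)); first by rewrite /a /b /c; ring.
  by rewrite EQ /e1; ring.
- by rewrite /a /b /c /e0; ring.
Qed.

End GluingIdentities.


(* With V = y + mu, the first gluing equation reads A' = - al A for al = 1 + V B (B + B'); with
   the other one and A^2 + A'^2 - x A A' = 1 it gives x (al - V B^2) = mu V B^2 - 1 - al^2. So
   x = nu / c below, where denominators in m are cleared, and substituting it into A' + al A = 0
   leaves an equation for y. If c = 0 then nu = 0, and the equation holds trivially. *)
Definition trace_eq (R : comNzRingType) (p q : nat) (m y : R) : R :=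
  let B := cheb y q in let B' := cheb y q.-1 in
  let n := m * y + m ^+ 2 + 1 in
  let al := m + n * B * (B + B') in
  let c := m * (m + n * B * B') in
  let nu := (m ^+ 2 + 1) * n * B ^+ 2 - m ^+ 2 - al ^+ 2 in
  m * c * lucas nu (c ^+ 2) p.-1 + al * lucas nu (c ^+ 2) p.

Lemma rmorph_cheb (R S : comNzRingType) (f : {rmorphism R -> S}) (x : R) n :
  f (cheb x n) = cheb (f x) n.
Proof. by rewrite /cheb rmorph_lucas rmorph1. Qed.

Lemma rmorph_trace_eq (R S : comNzRingType) (f : {rmorphism R -> S}) p q (m y : R) :
  f (trace_eq p q m y) = trace_eq p q (f m) (f y).
Proof.
rewrite /trace_eq.
by do 2 rewrite !(rmorphD, rmorphM, rmorphN, rmorphXn, rmorph1) ?rmorph_cheb ?rmorph_lucas.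
Qed.

Section TraceEquation.
Variable C : fieldType.

Definition gluing_curve p q (m x y : C) : Prop :=
  m != 0 /\ glued m x y (cheb x p) (cheb x p.-1) (cheb y q) (cheb y q.-1).

Lemma gluing_curveC p q m x y : gluing_curve p q m x y -> gluing_curve q p m y x.
Proof. by case=> mn G; split => //; apply: glued_swap. Qed.

Lemma cheb_cassini_pred p (x : C) : (0 < p)%N ->
  cheb x p ^+ 2 + cheb x p.-1 ^+ 2 - x * cheb x p * cheb x p.-1 = 1.
Proof. by case: p => // p _; apply: cheb_cassini. Qed.

Lemma trace_eq_curve p q m x y : (3 <= p)%N -> gluing_curve p q m x y ->
  trace_eq p q m y = 0.
Proof.
move=> p3 [m0 G]; have [An Bn Wn Vn] := glued_nz G; have [III IV _ _] := G.
have cA := cheb_cassini_pred x (ltn_trans (isT : 0 < 2)%N p3).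
rewrite /trace_eq.
set B := cheb y q in Bn III IV *; set B' := cheb y q.-1 in III IV *.
have mV : m * m^-1 = 1 by rewrite mulfV.
set V := y + m + m^-1 in III IV Vn *.
have -> : m * y + m ^+ 2 + 1 = m * V by rewrite -mV /V; ring.
set al := m + m * V * B * (B + B').
set c := m * (m + m * V * B * B').
set nu := _ - al ^+ 2.
set A := cheb x p in An III IV cA; set A' := cheb x p.-1 in III IV cA.
have EA : m * A' + al * A = 0.
  by rewrite /al -[RHS](mulr0 m) -III; ring.
have Enu : c * x = nu.
  apply: (mulIf (expf_neq0 2 An)); apply: (mulfI m0).
  have EA' : m * A' = - (al * A) by apply/eqP; rewrite -addr_eq0 EA.
  apply: (@eqr_comb0 _ _ _
    (m ^+ 3 * (A ^+ 2 + A' ^+ 2 - x * A * A' - 1)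
     - m * ((m * A' - (al * A)) * (m * A' + al * A))
     + m ^+ 2 * x * A * (m * A' + al * A)
     - m ^+ 3 * ((x + m + m^-1) * V * A ^+ 2 * B ^+ 2 - 1)
     - m ^+ 2 * (1 - m * m^-1) * V * A ^+ 2 * B ^+ 2)).
    by rewrite /nu /c /al; ring.
  by rewrite cA IV EA mV !subrr !mulr0 !mul0r !addr0 !subr0.
have [c0|cn] := eqVneq c 0.
  rewrite -Enu c0 mul0r expr0n /= mulr0 mul0r add0r.
  case: p p3 {III IV EA Enu An A A' cA Wn G} => [|[|p]] // _.
  by rewrite lucasSS !mul0r subrr mulr0.
apply: (mulfI cn); rewrite mulr0 mulrDr.
have L k : c * lucas nu (c ^+ 2) k = c ^+ k * cheb x k.
  by rewrite -Enu -[c ^+ 2]mulr1; apply: lucas_scale.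
transitivity (m * c * (c * lucas nu (c ^+ 2) p.-1) + al * (c * lucas nu (c ^+ 2) p)).
  by ring.
rewrite !L -/A -/A'; transitivity (c ^+ p * (m * A' + al * A)); last by rewrite EA mulr0.
have -> : c ^+ p = c * c ^+ p.-1 by rewrite -exprS prednK // (ltn_trans _ p3).
by ring.
Qed.

(** Here V = 0, so [al] = m, [c] = m^2 and [nu] = - 2 c, and [cheb_m2] evaluates the Lucas
    sequences. *)
Lemma trace_eq_neq0 p q (m : C) : (0 < p)%N -> m != 0 ->
  trace_eq p q m (- (m + m^-1)) != 0.
Proof.
move=> p0 m0; rewrite /trace_eq.
have -> : m * - (m + m^-1) + m ^+ 2 + 1 = 0.
  have mV : m * m^-1 = 1 by rewrite mulfV.
  by rewrite -mV; ring.
rewrite mulr0 !mul0r !addr0 sub0r; set c := m * m.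
have cn : c != 0 by rewrite mulf_neq0.
have -> : - m ^+ 2 - m ^+ 2 = c * (- 2%:R) by rewrite /c; ring.
have L k : c * lucas (c * - 2%:R) (c ^+ 2) k = c ^+ k * cheb (- 2%:R) k.
  by rewrite -[c ^+ 2]mulr1; apply: lucas_scale.
apply/eqP => /(congr1 ( *%R c)); rewrite mulr0 mulrDr.
have -> : c * (m * c * lucas (c * - 2%:R) (c ^+ 2) p.-1) =
  m * c * (c * lucas (c * - 2%:R) (c ^+ 2) p.-1) by ring.
rewrite [X in _ + X]mulrCA !L !cheb_m2; case: p p0 => // p _ /=.
have -> : m * c * (c ^+ p * - ((-1) ^+ p * p%:R)) +
  m * (c ^+ p.+1 * - ((-1) ^+ p.+1 * p.+1%:R)) = m * c ^+ p.+1 * (-1) ^+ p.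
  by rewrite !exprS -[p.+1]addn1 natrD; ring.
by apply/eqP; rewrite !mulf_neq0 ?expf_neq0 ?oppr_eq0 ?oner_eq0.
Qed.

End TraceEquation.

(** * The solutions lie on a plane curve *)

Section NotDense.
Variable C : closedFieldType.

Lemma horner2_trace_eq p q (m y : C) :
  (trace_eq p q 'Y 'X).[y, m] = trace_eq p q m y.
Proof.
have := rmorph_trace_eq (horner_eval m \o horner_eval y%:P) p q 'Y 'X.
by rewrite /= /horner_eval hornerC !hornerX hornerC.
Qed.

Lemma trace_algebraic (W : Type) (p q : nat) (m x y : W -> C) : (3 <= p)%N ->
  (forall w, gluing_curve p q (m w) (x w) (y w)) -> algebraic_over m y.
Proof.
move=> p3 HW; exists (trace_eq p q 'Y 'X); last first.
  by move=> w; rewrite horner2_trace_eq; apply: trace_eq_curve (HW w).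
apply/eqP => T0; have := horner2_trace_eq p q 1 (- (1 + 1^-1) : C).
rewrite T0 !horner0 => /esym/eqP; apply/negP.
by apply: trace_eq_neq0; rewrite ?oner_eq0 // (ltn_trans _ p3).
Qed.

Lemma cheb_algebraic (W : Type) (m x : W -> C) n :
  algebraic_over m x -> algebraic_over m (fun w => cheb (x w) n).
Proof.
move=> Hx; elim/nat_ind2: n => [||n IH0 IH1]; try exact: algebraic_over_cst.
apply: algebraic_over_ext (fun w => esym (chebSS _ _)).
exact: algebraic_over_sub (algebraic_over_mul Hx IH1) IH0.
Qed.

(** The trace equation makes y algebraic over m, exchanging the tails does so for x, and
    [glued_root] is rational in m, x and y. *)
Lemma gluing_curve_not_dense p q : (3 <= p)%N -> (3 <= q)%N ->
  exists2 g : {poly {poly C}}, g != 0 & forall m x y, gluing_curve p q m x y ->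
    g.[m, glued_root m (cheb x p) (cheb x p.-1) (cheb y q) (cheb y q.-1)] = 0.
Proof.
move=> p3 q3.
pose W := {w : C * C * C | gluing_curve p q w.1.1 w.1.2 w.2}.
pose m (w : W) := (sval w).1.1; pose x (w : W) := (sval w).1.2; pose y (w : W) := (sval w).2.
have HW w : gluing_curve p q (m w) (x w) (y w) by case: w.
have Hy : algebraic_over m y by apply: trace_algebraic HW.
have Hx : algebraic_over m x by apply: trace_algebraic (fun w => gluing_curveC (HW w)).
have Hm := algebraic_over_base m.
have HA n := cheb_algebraic n Hx; have HB n := cheb_algebraic n Hy.
have [G Gn HG] : algebraic_over m (fun w => glued_root (m w)
   (cheb (x w) p) (cheb (x w) p.-1) (cheb (y w) q) (cheb (y w) q.-1)).
  rewrite /glued_root; apply: algebraic_over_div => [||w].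
  - by do !(apply: algebraic_over_mul || apply: algebraic_over_add).
  - by do !(apply: algebraic_over_mul || apply: algebraic_over_add).
  by have [m0 [_ _ [? ?] [? ?]]] := HW w; rewrite !mulf_neq0.
exists (swapXY G); first by rewrite swapXY_eq0.
by move=> m1 x1 y1 H1; rewrite horner2_swapXY; apply: (HG (exist _ (m1, x1, y1) H1)).
Qed.

End NotDense.


(** * Infinitely many points on the gluing curve *)

Section ChebPolynomials.
Variable R : comNzRingType.

Lemma horner_cheb (x : R) n : (cheb 'X n).[x] = cheb x n.
Proof. by have := rmorph_cheb (horner_eval x) 'X n; rewrite /= /horner_eval hornerX. Qed.

Lemma size_cheb n : size (cheb 'X n : {poly R}) = n.
Proof.
suff [] : size (cheb 'X n : {poly R}) = n /\ size (cheb 'X n.+1 : {poly R}) = n.+1 by [].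
elim: n => [|n [IH0 IH1]]; first by rewrite /cheb /= size_poly0 size_poly1.
split=> //; have nz : cheb 'X n.+1 != 0 :> {poly R} by rewrite -size_poly_eq0 IH1.
by rewrite chebSS mulrC size_polyDl size_mulX // ?size_polyN ?IH0 IH1 // ltnS leqnSn.
Qed.

Definition chebD (x : R) n := cheb x n + cheb x n.-1.

End ChebPolynomials.

Lemma size_chebD (R : comNzRingType) n : size (chebD 'X n : {poly R}) = n.
Proof.
case: n => [|n]; first by rewrite /chebD /cheb /= addr0 size_poly0.
by rewrite /chebD size_polyDl !size_cheb.
Qed.

Lemma horner_chebD (R : comNzRingType) (x : R) n : (chebD 'X n).[x] = chebD x n.
Proof. by rewrite /chebD hornerD !horner_cheb. Qed.

Section Curve.
Variable C : fieldType.

Definition nonzero_cheb r (x : C) :=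
  forall k, (1 < k <= r)%N -> cheb x k != 0.

(** The curve in x and y that remains after elimination of mu = m + 1/m. *)
Definition theta p q (x y : C) : C :=
  chebD x p.+1 * chebD y q - chebD x p * chebD y q.+1.

Lemma thetaE p q x y : (0 < p)%N -> (0 < q)%N -> theta p q x y =
  (x + 2%:R) * cheb x p * chebD y q - (y + 2%:R) * cheb y q * chebD x p.
Proof.
by case: p q => [|p] [|q] // _ _; rewrite /theta /chebD /= !chebSS; ring.
Qed.

Lemma chebD_sq p (x : C) : (0 < p)%N ->
  chebD x p ^+ 2 = 1 + (x + 2%:R) * cheb x p * cheb x p.-1.
Proof.
move=> p0; apply: (@eqr_comb0 _ _ _ (cheb x p ^+ 2 + cheb x p.-1 ^+ 2 -
  x * cheb x p * cheb x p.-1 - 1)); first by rewrite /chebD; ring.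
by rewrite cheb_cassini_pred // subrr.
Qed.

(* On theta = 0 the locus A B = A' B' consists of spurious points, where gamma_E0 gamma_E1 = 0. *)
Lemma glued_of_theta p q (m x y : C) : (0 < p)%N -> (0 < q)%N -> m != 0 ->
  theta p q x y = 0 ->
  cheb x p != 0 -> cheb y q != 0 -> chebD x p != 0 -> chebD y q != 0 ->
  cheb x p * cheb y q != cheb x p.-1 * cheb y q.-1 ->
  (y + m + m^-1) * (cheb x p * cheb y q * chebD y q) = - chebD x p ->
  gluing_curve p q m x y.
Proof.
move=> p0 q0 m0; rewrite thetaE // => T0.
have cA := cheb_cassini_pred x p0; have cB := cheb_cassini_pred y q0.
have sA := chebD_sq x p0; have sB := chebD_sq y q0.
rewrite /gluing_curve; move: T0 sA sB cA cB; rewrite /chebD.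
move: (cheb x p) (cheb x p.-1) (cheb y q) (cheb y q.-1) => A A' B B'.
set FA := A + A'; set FB := B + B'; set W := x + m + m^-1; set V := y + m + m^-1.
move=> T0 sA sB cA cB An Bn FAn FBn nd EV.
have EW : W * (A * B * FA) = - FB.
  apply: (mulIf FBn).
  have -> : W = x - y + V by rewrite /W /V; ring.
  have cB' : (y + 2%:R) * B ^+ 2 - 1 = FB * ((y + 2%:R) * B - FB).
    by rewrite mulrBr -expr2 sB /FB; ring.
  have cA' : (x + 2%:R) * A ^+ 2 - 1 = FA * ((x + 2%:R) * A - FA).
    by rewrite mulrBr -expr2 sA /FA; ring.
  apply: (@eqr_comb0 _ _ _
   (FA * (V * (A * B * FB) + FA)
    + FA ^+ 2 * ((y + 2%:R) * B ^+ 2 - 1 - FB * ((y + 2%:R) * B - FB))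
    - FB ^+ 2 * ((x + 2%:R) * A ^+ 2 - 1 - FA * ((x + 2%:R) * A - FA))
    + ((x + 2%:R) * A * FB - (y + 2%:R) * B * FA) * (B * FA + A * FB - FA * FB))).
    by ring.
  by rewrite T0 cA' cB' EV addNr !subrr !(mulr0, mul0r) subr0 !addr0.
have Fn : FA * FB != 0 by rewrite mulf_neq0.
have hA := mul_holonomy_factors m0 cA; have hB := mul_holonomy_factors m0 cB.
rewrite -/W in hA; rewrite -/V in hB.
have nW : 1 + W * A * A' != 0.
  apply: contra_neq nd => E; apply/eqP; rewrite -subr_eq0; apply/eqP.
  transitivity (B * FA * (1 + W * A * A') - A' * (W * (A * B * FA) + FB)).
    by rewrite /FA /FB; ring.
  by rewrite E EW addNr !mulr0 subrr.
have nV : 1 + V * B * B' != 0.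
  apply: contra_neq nd => E; apply/eqP; rewrite -subr_eq0; apply/eqP.
  transitivity (A * FB * (1 + V * B * B') - B' * (V * (A * B * FB) + FA)).
    by rewrite /FA /FB; ring.
  by rewrite E EV addNr !mulr0 subrr.
split=> //; rewrite /glued -/W -/V; split.
- by rewrite -/FA -/FB -[RHS](addrN FA) -EV; ring.
- by apply: (mulIf Fn); rewrite mul1r -[RHS]mulrNN -EW -EV; ring.
- by apply/andP; rewrite -negb_or -mulf_eq0 hA mulf_neq0.
- by apply/andP; rewrite -negb_or -mulf_eq0 hB mulf_neq0.
Qed.

End Curve.

Section InfinitelyManyPoints.
Variable C : numClosedFieldType.

Lemma chebX_neq0 n : (0 < n)%N -> cheb 'X n != 0 :> {poly C}.
Proof. by move=> n0; rewrite -size_poly_eq0 size_cheb -lt0n. Qed.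

Lemma chebDX_neq0 n : (0 < n)%N -> chebD 'X n != 0 :> {poly C}.
Proof. by move=> n0; rewrite -size_poly_eq0 size_chebD -lt0n. Qed.

Lemma prod_roots_cover (I : eqType) (r : seq I) (F : I -> {poly C}) :
  (forall i, i \in r -> F i != 0) ->
  exists2 D : {poly C}, D != 0 & forall y i, i \in r -> D.[y] != 0 -> (F i).[y] != 0.
Proof.
move=> Fn; exists (\prod_(i <- r) F i).
  by rewrite prodf_seq_neq0; apply/allP => i /Fn.
move=> y i ir; rewrite horner_prod prodf_seq_neq0 => /allP/(_ _ ir).
by [].
Qed.

Definition theta_poly p q (x0 : C) : {poly C} :=
  (chebD x0 p.+1)%:P * chebD 'X q - (chebD x0 p)%:P * chebD 'X q.+1.

Lemma horner_theta_poly p q x0 y : (theta_poly p q x0).[y] = theta p q x0 y.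
Proof. by rewrite /theta_poly /theta hornerD hornerN !hornerM !hornerC !horner_chebD. Qed.

(** The leading coefficient in y is [- chebD x0 p]. If it is zero, [chebD_sq] prevents
    [chebD x0 p.+1] from vanishing too. *)
Lemma theta_poly_neq0 p q x0 : (0 < p)%N -> (0 < q)%N -> theta_poly p q x0 != 0.
Proof.
move=> p0 q0; rewrite /theta_poly.
have [E|n] := eqVneq (chebD x0 p) 0; last first.
  rewrite addrC -size_poly_eq0.
  have sz : size (- ((chebD x0 p)%:P * chebD 'X q.+1)) = q.+1.
    by rewrite size_polyN mul_polyC size_scale // size_chebD.
  rewrite size_polyDl sz // mul_polyC.
  by apply: leq_ltn_trans (size_scale_leq _ _) _; rewrite size_chebD.
rewrite E polyC0 mul0r subr0 mulf_neq0 ?chebDX_neq0 // polyC_eq0.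
have sA := chebD_sq x0 p0; rewrite E in sA.
case: p p0 E sA => // p _; rewrite /chebD /= chebSS => E sA.
apply/eqP => E2.
have E3 : (x0 + 2%:R) * cheb x0 p.+1 = 0.
  by rewrite -[RHS]addr0 -{1}E2 -E; ring.
by move/eqP: sA; rewrite E3 mul0r addr0 expr0n /= eq_sym oner_eq0.
Qed.

(* Where theta = 0 and A B = A' B', x = xi / B'; degen_poly is A B = A' B' at that x, with the
   denominators cleared. *)
Definition degen_poly p q : {poly C} :=
  let B := cheb 'X q in let B' := cheb 'X q.-1 in
  let xi := ('X + 2%:R) * B - 2%:R * B' in
  B * lucas xi (B' ^+ 2) p - B' ^+ 2 * lucas xi (B' ^+ 2) p.-1.

Lemma horner_degen_poly p q x y : (0 < p)%N ->
  (x + 2%:R) * cheb y q.-1 = (y + 2%:R) * cheb y q ->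
  cheb y q.-1 * (degen_poly p q).[y] =
  cheb y q.-1 ^+ p * (cheb x p * cheb y q - cheb x p.-1 * cheb y q.-1).
Proof.
move=> p0 E; rewrite /degen_poly.
have -> (P : {poly C}) : P.[y] = horner_eval y P by [].
do 2 rewrite !(rmorph_nat, rmorphXn, rmorphD, rmorphM, rmorphN) ?rmorph_cheb ?rmorph_lucas.
rewrite /= /horner_eval hornerX.
set B := cheb y q in E *; set B' := cheb y q.-1 in E *.
have -> : (y + 2%:R) * B - 2%:R * B' = B' * x by rewrite -E; ring.
have L k : B' * lucas (B' * x) (B' ^+ 2) k = B' ^+ k * cheb x k.
  by rewrite -[B' ^+ 2]mulr1; apply: lucas_scale.
transitivity (B * (B' * lucas (B' * x) (B' ^+ 2) p)
   - B' ^+ 2 * (B' * lucas (B' * x) (B' ^+ 2) p.-1)); first by ring.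
rewrite !L; have -> : B' ^+ p = B' * B' ^+ p.-1 by rewrite -exprS prednK.
by ring.
Qed.

(** At x = y = -2 the relation of [horner_degen_poly] holds trivially, and A B - A' B' is p q -
    (p-1) (q-1) up to sign, nonzero in characteristic 0. *)
Lemma degen_poly_neq0 p q : (1 < p)%N -> (1 < q)%N -> degen_poly p q != 0.
Proof.
move=> p1 q1; apply/eqP => D0.
have := @horner_degen_poly p q (- 2%:R) (- 2%:R) (ltnW p1).
rewrite !addNr !mul0r => /(_ erefl); rewrite D0 horner0 mulr0 => /esym/eqP.
case: p q p1 q1 {D0} => [|[|p]] [|[|q]] // _ _; apply/negP.
rewrite (_ : p.+2.-1 = p.+1) // (_ : q.+2.-1 = q.+1) // !cheb_m2.
have sgn k : (-1) ^+ k != 0 :> C by rewrite expf_neq0 // oppr_eq0 oner_eq0.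
rewrite mulf_neq0 ?expf_neq0 ?oppr_eq0 ?mulf_neq0 ?sgn ?pnatr_eq0 //.
have -> : - ((-1) ^+ p.+2 * p.+2%:R) * - ((-1) ^+ q.+2 * q.+2%:R) -
   - ((-1) ^+ p.+1 * p.+1%:R) * - ((-1) ^+ q.+1 * q.+1%:R) =
   (-1) ^+ p * (-1) ^+ q * (p + q + 3)%:R :> C.
  by rewrite !exprS !natrD -![_.+2%:R]natr1 -![_.+1%:R]natr1; ring.
by rewrite !mulf_neq0 // pnatr_eq0 addnS.
Qed.

(** A generic y is fixed first, then a root x of [theta], then m. The product [D] collects what y
    must avoid: zeros of its brackets, the curve over each bad x, the trace equation at each m in
    [F], and the spurious points. *)
Lemma gluing_curve_infinite p q (F : seq C) : (3 <= p)%N -> (3 <= q)%N ->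
  exists m x y, [/\ m \notin F, gluing_curve p q m x y,
    nonzero_cheb p x & nonzero_cheb q y].
Proof.
move=> p3 q3; have p0 := ltnW (ltnW p3); have q0 := ltnW (ltnW q3).
have [ip ip'] : (1 < p <= p /\ 1 < p.-1 <= p)%N by split; lia.
have [iq iq'] : (1 < q <= q /\ 1 < q.-1 <= q)%N by split; lia.
have nzch r : exists2 D : {poly C}, D != 0 & forall y, D.[y] != 0 -> nonzero_cheb r y.
  have [|D Dn HD] := @prod_roots_cover _ (iota 2 r) (fun k => cheb 'X k).
    by move=> k; rewrite mem_iota => /andP[k2 _]; apply: chebX_neq0; lia.
  exists D => // y Dy k kr; rewrite -horner_cheb; apply: HD Dy.
  by rewrite mem_iota; lia.
have [Dp Dpn HDp] := nzch p; have [Dq Dqn HDq] := nzch q.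
have [rx Hrx] := poly_roots_seq (mulf_neq0 Dpn (chebDX_neq0 p0)).
have [|D1 D1n HD1] := @prod_roots_cover _ rx (theta_poly p q).
  by move=> x0 _; apply: theta_poly_neq0.
have [|D2 D2n HD2] := @prod_roots_cover _ [seq m <- F | m != 0]
  (fun m => trace_eq p q m%:P 'X).
  move=> m; rewrite mem_filter => /andP[m0 _]; apply/eqP => T0.
  have := rmorph_trace_eq (horner_eval (- (m + m^-1))) p q m%:P 'X.
  rewrite T0 /= /horner_eval horner0 hornerC hornerX => /esym/eqP.
  by apply/negP; apply: trace_eq_neq0.
pose D := Dq * chebD 'X q * D1 * D2 * degen_poly p q.
have Dn : D != 0.
  by rewrite !mulf_neq0 ?chebDX_neq0 ?degen_poly_neq0 // ltnW.
have [y Dy] : exists y, D.[y] != 0.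
  apply: contrapT => H; case/eqP: Dn; apply: (@poly_eq0_off_seq _ D [::]) => y _.
  by apply/eqP; apply/negPn/negP => Dy; apply: H; exists y.
move: Dy; rewrite !hornerM !mulf_eq0 !negb_or horner_chebD.
move=> /andP[/andP[/andP[/andP[/HDq yq FBn] D1y] D2y] dg].
have [|x xr] := closed_rootP ((chebD y q)%:P * chebD 'X p.+1 - (chebD y q.+1)%:P * chebD 'X p) _.
  have lt : (size (- ((chebD y q.+1)%:P * chebD 'X p))%R
      < size ((chebD y q)%:P * chebD 'X p.+1)%R)%N.
    rewrite size_polyN !mul_polyC (size_scale _ FBn) size_chebD.
    by apply: leq_ltn_trans (size_scale_leq _ _) _; rewrite size_chebD.
  by rewrite size_polyDl // mul_polyC size_scale // size_chebD eqSS -lt0n.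
have T0 : theta p q x y = 0.
  move/rootP: xr; rewrite hornerD hornerN !hornerM !hornerC !horner_chebD => <-.
  by rewrite /theta; ring.
have Ex : (Dp * chebD 'X p).[x] != 0.
  apply/negP => /Hrx /(HD1 y)/(_ D1y).
  by rewrite horner_theta_poly T0 eqxx.
move: Ex; rewrite hornerM mulf_eq0 negb_or horner_chebD => /andP[/HDp xp FAn].
have An : cheb x p != 0 by exact: xp.
have A'n : cheb x p.-1 != 0 by exact: xp.
have Bn : cheb y q != 0 by exact: yq.
have B'n : cheb y q.-1 != 0 by exact: yq.
have nd : cheb x p * cheb y q != cheb x p.-1 * cheb y q.-1.
  apply/eqP => E; have E' : (x + 2%:R) * cheb y q.-1 = (y + 2%:R) * cheb y q.
    apply: (mulfI A'n); apply: (mulfI FBn).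
    move: T0; rewrite thetaE // => T0.
    apply: (@eqr_comb0 _ _ _
      (((x + 2%:R) * cheb x p * chebD y q - (y + 2%:R) * cheb y q * chebD x p) * cheb y q
       - ((x + 2%:R) * chebD y q - (y + 2%:R) * cheb y q)
         * (cheb x p * cheb y q - cheb x p.-1 * cheb y q.-1))).
      by rewrite /chebD; ring.
    by rewrite T0 E subrr mul0r mulr0 subrr.
  have /eqP := horner_degen_poly p0 E'; rewrite E subrr mulr0.
  by rewrite mulf_eq0 (negPf B'n) (negPf dg).
(* The first gluing equation, solved for m + 1/m. *)
pose mu := - y - chebD x p / (cheb x p * cheb y q * chebD y q).
have [|m /rootP mr] := closed_rootP ('X^2 + (- mu *: 'X + 1%:P)) _.
  have lt : (size (- mu *: 'X + 1%:P : {poly C})%R < size ('X^2 : {poly C})%R)%N.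
    rewrite size_polyXn (leq_ltn_trans (size_polyD _ _)) // gtn_max size_polyC oner_eq0.
    by rewrite (leq_ltn_trans (size_scale_leq _ _)) // size_polyX.
  by rewrite size_polyDl // size_polyXn.
rewrite hornerD hornerXn hornerD hornerZ hornerX hornerC in mr.
have m0 : m != 0.
  by apply: contra_eqN mr => /eqP->; rewrite mulr0 expr0n /= !add0r oner_eq0.
have Emu : m + m^-1 = mu.
  apply: (mulfI m0); rewrite mulrDr mulfV //; apply: (@eqr_comb0 _ _ _ _ _ mr).
  by ring.
have G : gluing_curve p q m x y.
  apply: glued_of_theta => //; rewrite -addrA Emu /mu addrA subrr add0r mulNr divfK //.
  by rewrite !mulf_neq0.
exists m, x, y; split => //; apply/negP => mF.
have mF' : m \in [seq m <- F | m != 0] by rewrite mem_filter m0.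
have := HD2 y m mF' D2y; rewrite -[(trace_eq _ _ _ _).[y]]/(horner_eval y _).
rewrite rmorph_trace_eq /= /horner_eval hornerC hornerX.
by rewrite (trace_eq_curve p3 G) eqxx.
Qed.
End InfinitelyManyPoints.

(** * Representations of the knot group *)


Section Matrices.
Variable C : fieldType.
Implicit Types (a b c d : C) (X Y : 'M[C]_2).

Definition mx2 a b c d : 'M[C]_2 :=
  \matrix_(i, j) if i == 0 then if j == 0 then a else b else if j == 0 then c else d.

Lemma mx2E X : X = mx2 (X 0 0) (X 0 1) (X 1 0) (X 1 1).
Proof.
apply/matrixP => i j; rewrite !mxE.
by case: i j => [[|[|i]] //= Hi] [[|[|j]] //= Hj]; congr (X _ _); apply: val_inj.
Qed.

Lemma mul_mx2 a b c d a' b' c' d' : mx2 a b c d * mx2 a' b' c' d' =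
  mx2 (a * a' + b * c') (a * b' + b * d') (c * a' + d * c') (c * b' + d * d').
Proof.
rewrite [LHS]mx2E; congr mx2; rewrite -mulmxE !mxE big_ord_recl big_ord1 !mxE //=.
Qed.

Lemma lin_mx2 (k l : C) a b c d : k *: mx2 a b c d + l%:A =
  mx2 (k * a + l) (k * b) (k * c) (k * d + l).
Proof.
by rewrite [LHS]mx2E; congr mx2; rewrite !mxE /= ?mulr1 ?mulr0 ?addr0.
Qed.

Lemma det_mx2 a b c d : \det (mx2 a b c d) = a * d - b * c.
Proof.
rewrite (expand_det_row _ 0) big_ord_recl big_ord1 /cofactor !det_mx11 !mxE /=.
by rewrite expr0 expr1; ring.
Qed.

Lemma mx2_1 : 1 = mx2 1 0 0 1.
Proof. by rewrite [LHS]mx2E; congr mx2; rewrite !mxE. Qed.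

Lemma mx2_inv a b c d : a * d - b * c = 1 ->
  mx2 a b c d \is a GRing.unit /\ (mx2 a b c d)^-1 = mx2 d (- b) (- c) a.
Proof.
move=> D; have E : mx2 d (- b) (- c) a * mx2 a b c d = 1.
  by rewrite mul_mx2 mx2_1 -D; congr mx2; ring.
have U : mx2 a b c d \is a GRing.unit.
  by rewrite unitmxE det_mx2 D unitr1.
by split=> //; rewrite -[LHS]mul1r -E mulrK.
Qed.

(** The hypothesis is Cayley-Hamilton for determinant 1 and trace - x. The sign is invisible in
    PSL(2, C). *)
Lemma cheb_power (x : C) X n : X ^+ 2 = - x *: X - 1 ->
  X ^+ n.+1 = (-1) ^+ n *: (cheb x n.+1 *: X + (cheb x n)%:A).
Proof.
move=> X2; elim: n => [|n IH].
  by rewrite expr1 expr0 /cheb /= scale0r addr0 !scale1r.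
have key (c1 c0 : C) :
    c1 *: (- x *: X - 1) + c0 *: X = - ((x * c1 - c0) *: X + c1%:A).
  rewrite scalerBr scalerA scalerBl mulrN scaleNr [c1 * x]mulrC.
  by rewrite !opprD opprK addrAC.
rewrite exprSr IH -scalerAl mulrDl -!scalerAl mul1r -expr2 X2 chebSS key.
by rewrite scalerN -scaleNr -mulN1r -exprS.
Qed.

(** For the two crossings where C passes under B: both B1 and B2 must conjugate C2 into C1. *)
Lemma intertwiner_mx2 (M N z a b d : C) (X := mx2 a b (z * b) d) :
  d = (N - M) * b -> mx2 M 1 0 N * X = X * mx2 M 0 z N.
Proof. by move=> Dd; rewrite !mul_mx2 Dd; congr mx2; ring. Qed.

End Matrices.

Section Words.
Variables (G : Type) (V : unitRingType) (rho : G -> V).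

Lemma word_eval_cat (w1 w2 : word G) :
  word_eval rho (w1 ++ w2) = word_eval rho w1 * word_eval rho w2.
Proof. by rewrite /word_eval big_cat. Qed.

Lemma word_eval_pow (w : word G) k : word_eval rho (word_pow w k) = word_eval rho w ^+ k.
Proof.
elim: k => [|k IH]; first by rewrite /word_eval big_nil.
by rewrite /word_pow /= word_eval_cat exprS -IH.
Qed.

End Words.

Section Representation.
Variables (C : fieldType) (p q : nat) (M x y : C).
Hypotheses (p0 : (0 < p)%N) (q0 : (0 < q)%N) (M0 : M != 0).
Hypothesis curve : gluing_curve p q (M ^+ 2) x y.

Let A := cheb x p. Let A' := cheb x p.-1. Let B := cheb y q. Let B' := cheb y q.-1.
Let z := x + 2%:R. Let N := M^-1. Let F := A + A'. Let E := F - z * A.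
Let W := x + M ^+ 2 + (M ^+ 2)^-1.

(* g, h, u, v stand for C1, C2, C2 C1^-1, A2 A1^-1. Up to sign, A1 = u^p = A u + A' and
   B1 = v^q = B v + B', because - x and - y are the traces of u and v. *)
Let g := mx2 M 1 0 N.
Let h := mx2 M 0 z N.
Let u := mx2 1 (- M) (z * N) (1 - z).
Let a1 := mx2 F (- A * M) (A * z * N) E.
Let a2 := mx2 E (- A * N) (A * M * z) F.
Let v := mx2 (E ^+ 2 + A ^+ 2 * N ^+ 2 * z) (A * (M * E - N * F))
             (z * (A * (M * E - N * F))) (A ^+ 2 * M ^+ 2 * z + F ^+ 2).
Let beta1 := B * A * (M * E - N * F).
Let beta2 := B * A * (M * F - N * E).
Let d1 := B * (A ^+ 2 * M ^+ 2 * z + F ^+ 2) + B'.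
Let d2 := B * (A ^+ 2 * N ^+ 2 * z + F ^+ 2) + B'.
Let b1 := mx2 (B * (E ^+ 2 + A ^+ 2 * N ^+ 2 * z) + B') beta1 (z * beta1) d1.
Let b2 := mx2 (B * (E ^+ 2 + A ^+ 2 * M ^+ 2 * z) + B') beta2 (z * beta2) d2.

Let MN : M * N = 1. Proof. exact: mulfV. Qed.
Let cA : A ^+ 2 + A' ^+ 2 - x * A * A' = 1. Proof. exact: cheb_cassini_pred. Qed.
Let cB : B ^+ 2 + B' ^+ 2 - y * B * B' = 1. Proof. exact: cheb_cassini_pred. Qed.
Let m0 : M ^+ 2 != 0. Proof. by rewrite expf_neq0. Qed.
Let W_E : W = x + M ^+ 2 + N ^+ 2. Proof. by rewrite /W exprVn. Qed.
Let FE : F * E + A ^+ 2 * z = 1.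
Proof. by rewrite -cA /E /F /z; ring. Qed.
Let relB : B + B' = - W * B * A * F.
Proof.
have := glued_swap_eq curve.2; rewrite -/A -/A' -/B -/B' -/W -/F => Eq.
by apply: (@eqr_comb0 _ _ _ (B + B' + W * B * A * F)) => //; ring.
Qed.
Let relY : y + 2%:R = - z * W * A ^+ 2.
Proof. exact: (glued_traceB m0 cA cB curve.2). Qed.

(** The hypothesis of [intertwiner_mx2] for B1. The one for B2, which follows, reduces to [relB] by
    the same combination. *)
Let D1 : d1 = (N - M) * beta1.
Proof.
apply: (@eqr_comb0 _ _ _ (B + B' + W * B * A * F - (W - (x + M ^+ 2 + N ^+ 2)) * B * A * F
  + B * (F * E + A ^+ 2 * z - 1) + (1 - M * N) * B * A * (E + F))).
  by rewrite /d1 /beta1 /E /z; ring.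
by rewrite relB -W_E FE MN !mulNr addNr !subrr !mul0r mulr0 subr0 !addr0.
Qed.

Let D2 : d2 = (N - M) * beta2.
Proof.
apply: (@eqr_comb0 _ _ _ (B + B' + W * B * A * F - (W - (x + M ^+ 2 + N ^+ 2)) * B * A * F
  + B * (F * E + A ^+ 2 * z - 1) + (1 - M * N) * B * A * (E + F))).
  by rewrite /d2 /beta2 /E /z; ring.
by rewrite relB -W_E FE MN !mulNr addNr !subrr !mul0r mulr0 subr0 !addr0.
Qed.

Let detv : (E ^+ 2 + A ^+ 2 * N ^+ 2 * z) * (A ^+ 2 * M ^+ 2 * z + F ^+ 2)
   - z * (A * (M * E - N * F)) ^+ 2 = 1.
Proof.
apply: (@eqr_comb0 _ _ _ ((F * E + A ^+ 2 * z - 1) * (F * E + A ^+ 2 * z + 1)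
  + (M * N - 1) * (A ^+ 4 * z ^+ 2 * (M * N + 1) + 2%:R * z * A ^+ 2 * E * F))).
  by ring.
by rewrite FE MN !subrr !mul0r addr0.
Qed.

Let trv : (E ^+ 2 + A ^+ 2 * N ^+ 2 * z) + (A ^+ 2 * M ^+ 2 * z + F ^+ 2) = - y.
Proof.
apply: (@eqr_comb0 _ _ _ (y + 2%:R + z * W * A ^+ 2
   - (W - (x + M ^+ 2 + N ^+ 2)) * z * A ^+ 2 + 2%:R * (F * E + A ^+ 2 * z - 1))).
  by rewrite /E /z; ring.
by rewrite relY -W_E FE !mulNr addNr !subrr !mul0r mulr0 subr0 addr0.
Qed.

Let det1 : (B * (E ^+ 2 + A ^+ 2 * N ^+ 2 * z) + B') * d1 - beta1 * (z * beta1) = 1.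
Proof.
apply: (@eqr_comb0 _ _ _ (B ^+ 2 * ((E ^+ 2 + A ^+ 2 * N ^+ 2 * z) *
    (A ^+ 2 * M ^+ 2 * z + F ^+ 2) - z * (A * (M * E - N * F)) ^+ 2 - 1)
  + B * B' * ((E ^+ 2 + A ^+ 2 * N ^+ 2 * z) + (A ^+ 2 * M ^+ 2 * z + F ^+ 2) + y)
  + (B ^+ 2 + B' ^+ 2 - y * B * B' - 1))).
  by rewrite /d1 /beta1; ring.
by rewrite detv trv cB addNr !subrr !mulr0 !addr0.
Qed.

Let det2 : (B * (E ^+ 2 + A ^+ 2 * M ^+ 2 * z) + B') * d2 - beta2 * (z * beta2) = 1.
Proof.
rewrite -[RHS]det1 /d1 /d2 /beta1 /beta2.
apply: (@eqr_comb0 _ _ _ 0) => //; ring.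
Qed.

Let ga2 : g * a2 = a1 * g.
Proof. by rewrite !mul_mx2; congr mx2; rewrite /E; ring. Qed.

Let uh : u * g = h.
Proof. by rewrite !mul_mx2; congr mx2; rewrite /N; field. Qed.

Let a1u : a1 = A *: u + A'%:A.
Proof. by rewrite lin_mx2; congr mx2; rewrite /E /F; ring. Qed.

Let b1v : b1 = B *: v + B'%:A.
Proof. by rewrite lin_mx2; congr mx2; rewrite /d1 /beta1; ring. Qed.


Let a1V : a1 \is a GRing.unit /\ a1^-1 = mx2 E (A * M) (- (A * z * N)) F.
Proof.
have [] := @mx2_inv C F (- A * M) (A * z * N) E.
  apply: (@eqr_comb0 _ _ _ (F * E + A ^+ 2 * z - 1 + (M * N - 1) * A ^+ 2 * z)).
    by ring.
  by rewrite FE MN !subrr !mul0r addr0.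
by move=> U V; split=> //; rewrite V mulNr opprK.
Qed.

Let va1 : v * a1 = a2.
Proof.
suff -> : v = a2 * a1^-1 by rewrite divrK //; case: a1V.
by rewrite a1V.2 mul_mx2; congr mx2; ring.
Qed.

(** [b2] is the same linear combination of [a1^-1 * a2], a conjugate of [v] by [a1], as [b1] is of
    [v]. *)
Let a1b2 : a1 * b2 = b1 * a1.
Proof.
have -> : b2 = B *: (a1^-1 * a2) + B'%:A.
  by rewrite a1V.2 mul_mx2 lin_mx2; congr mx2; rewrite /beta2 /d2; ring.
rewrite b1v mulrDl mulrDr -scalerAl -scalerAr va1 mulrA divrr ?mul1r ?a1V.1 //.
by rewrite -scalerAl -scalerAr mulr1 mul1r.
Qed.

Let u_sq : u ^+ 2 = - x *: u - 1.
Proof.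
by rewrite expr2 mul_mx2 -scaleN1r lin_mx2; congr mx2; rewrite /N /z; field.
Qed.

Let v_sq : v ^+ 2 = - y *: v - 1.
Proof.
rewrite expr2 mul_mx2 -scaleN1r lin_mx2 -trv -detv; congr mx2; ring.
Qed.

Let det_uv : [/\ \det g = 1, \det h = 1, \det u = 1, \det v = 1 & \det a1 = 1].
Proof.
split; rewrite det_mx2.
- by rewrite mul1r subr0.
- by rewrite mul0r subr0.
- by rewrite /N; field.
- by rewrite -[RHS]detv; ring.
- apply: (@eqr_comb0 _ _ _ (F * E + A ^+ 2 * z - 1 + (M * N - 1) * A ^+ 2 * z)).
    by ring.
  by rewrite FE MN !subrr !mul0r addr0.
Qed.

Let unit_det (X : 'M[C]_2) : \det X = 1 -> X \is a GRing.unit.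
Proof. by move=> D; rewrite unitmxE D unitr1. Qed.

Let gb1 : g * b1 = b1 * h.
Proof. exact: intertwiner_mx2 D1. Qed.

Let gb2 : g * b2 = b2 * h.
Proof. exact: intertwiner_mx2 D2. Qed.

(** The longitude is B1 B2^-1, upper triangular by [D1] and [D2]. Its first entry simplifies to
    [beta2 / beta1] because [b1] has determinant 1. *)
Let longitude_entry : (b1 * b2^-1) 1 0 = 0 /\
  (b1 * b2^-1) 0 0 = - glued_root (M ^+ 2) A A' B B'.
Proof.
have [_ ->] := mx2_inv det2.
rewrite mul_mx2 !mxE /= D1 D2; split; first by ring.
have b1n : beta1 != 0.
  apply: contra_eqN det1 => /eqP b0; rewrite D1 b0 !mulr0 subr0.
  by rewrite eq_sym oner_eq0.
have [_ _ [nA nA'] [nB nB']] := curve.2.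
have L : (B * (E ^+ 2 + A ^+ 2 * N ^+ 2 * z) + B') * ((N - M) * beta2)
   + beta1 * - (z * beta2) = beta2 / beta1.
  apply: (mulIf b1n); rewrite divfK // -[RHS]mulr1 -det1 D1.
  by ring.
rewrite L /glued_root; apply: (mulIf b1n); rewrite divfK // mulNr.
have := glued_longitude m0 cA curve.2; rewrite -/A -/A' -/B -/B' -/F -/z => EL.
have den : M ^+ 2 * (M ^+ 2 * A + A') * (M ^+ 2 * B + B') != 0.
  by rewrite !mulf_neq0.
apply: (mulIf den); rewrite mulNr [_ / _ * _ * _]mulrAC divfK //.
apply: (mulfI M0); rewrite /beta1 /beta2.
apply: (@eqr_comb0 _ _ _ (- B * A * ((z * M ^+ 2 * A - (M ^+ 2 - 1) * F) * (A + M ^+ 2 * A') *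
    (B + M ^+ 2 * B') - (z * A + (M ^+ 2 - 1) * F) * M ^+ 2 * (M ^+ 2 * A + A') *
    (M ^+ 2 * B + B')))).
  by rewrite /E /N; field.
by rewrite EL subrr mulr0.
Qed.

Definition double_twist_rep (a : Defs.arc) : 'M[C]_2 :=
  match a with
  | A1 => a1 | A2 => a2 | B1 => b1 | B2 => b2 | C1 => g | C2 => h
  end.

Lemma PSL_eigenvalues_gluing_curve :
  PSL_eigenvalues (double_twist_knot p q) M (glued_root (M ^+ 2) A A' B B').
Proof.
have [dg dh du dv da1] := det_uv.
have [Ug Uh Uu Uv Ua1] : [/\ g \is a GRing.unit, h \is a GRing.unit,
  u \is a GRing.unit, v \is a GRing.unit & a1 \is a GRing.unit].
  by split; apply: unit_det.
have da2 : \det a2 = 1 by rewrite -va1 det_mulmx dv da1 mulr1.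
have db1 : \det b1 = 1 by rewrite det_mx2 det1.
have db2 : \det b2 = 1 by rewrite det_mx2 det2.
have [Ua2 Ub1 Ub2] : [/\ a2 \is a GRing.unit, b1 \is a GRing.unit & b2 \is a GRing.unit].
  by split; apply: unit_det.
have ua1 : u * a1 = a1 * u.
  by rewrite a1u mulrDr mulrDl -!scalerAr -!scalerAl mulr1 mul1r.
have vb1 : v * b1 = b1 * v.
  by rewrite b1v mulrDr mulrDl -!scalerAr -!scalerAl mulr1 mul1r.
have R1 : a1 * h = h * a2 by rewrite -uh mulrA -ua1 -!mulrA ga2.
have R3 : b1 * a2 = a2 * b2 by rewrite -va1 mulrA -vb1 -!mulrA a1b2.
(* The filling relators: lambdaA and lambdaB evaluate to [u] and [v], and the meridian is plus or
   minus their n-th power by [cheb_power]. *)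
have slope (X : 'M[C]_2) Y t n : (0 < n)%N -> X \is a GRing.unit ->
    X ^+ 2 = - t *: X - 1 -> Y = cheb t n *: X + (cheb t n.-1)%:A ->
    Y * X^-1 ^+ n = 1 \/ Y * X^-1 ^+ n = -1.
  case: n => // n _ UX X2 ->; have := cheb_power n X2 => P.
  have -> : cheb t n.+1 *: X + (cheb t n.+1.-1)%:A = (-1) ^+ n *: X ^+ n.+1.
    by rewrite P scalerA -exprMn mulrNN mulr1 expr1n scale1r.
  rewrite -scalerAl exprVn mulrV ?unitrX //.
  rewrite -signr_odd; case: (odd n).
    by right; rewrite expr1 scaleN1r.
  by left; rewrite expr0 scale1r.
exists double_twist_rep; split.
- split=> [|i]; first by case.
  move=> Hi; rewrite /=.
  (* The Wirtinger relator at a positive crossing; [wV] treats a negative one. *)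
  have wE (X Y Z T : 'M[C]_2) : X \is a GRing.unit -> Y \is a GRing.unit ->
     T \is a GRing.unit -> Y * X = Z * T -> X^-1 * (Y^-1 * (Z * (T * 1))) = 1.
    by move=> UX UY UT E1; rewrite mulr1 -E1 mulKr // mulVr.
  have wV (X Y Z T : 'M[C]_2) : X \is a GRing.unit -> T \is a GRing.unit ->
     X * T = Y * Z -> X^-1 * (Y * (Z * (T^-1 * 1))) = 1.
    by move=> UX UT E1; rewrite mulr1 [Y * _]mulrA -E1 -mulrA mulrV // mulr1 mulVr.
  case: i Hi => [|[|[|[|[|[|[|[|i]]]]]]]] //= _; rewrite /word_eval.
  + by left; rewrite !big_cons big_nil /=; apply: wE.
  + by left; rewrite !big_cons big_nil /=; apply: wV.
  + by left; rewrite !big_cons big_nil /=; apply: wE.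
  + by left; rewrite !big_cons big_nil /=; apply: wV.
  + by left; rewrite !big_cons big_nil /=; apply: wE.
  + by left; rewrite !big_cons big_nil /=; apply: wV.
  + rewrite -/(word_eval double_twist_rep _) word_eval_cat word_eval_pow /word_eval.
    rewrite !big_cons !big_nil /= !mulr1.
    have -> : g * h^-1 = u^-1 by rewrite -uh invrM // mulrA mulrV // mul1r.
    exact: (slope u a1 x p p0 Uu u_sq a1u).
  + rewrite -/(word_eval double_twist_rep _) word_eval_cat word_eval_pow /word_eval.
    rewrite !big_cons !big_nil /= !mulr1.
    have -> : a1 * a2^-1 = v^-1 by rewrite -va1 invrM // mulrA mulrV // mul1r.
    exact: (slope v b1 y q q0 Uv v_sq b1v).
- rewrite /word_eval big_cons big_nil /= mulr1; split; rewrite !mxE //.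
  by left.
- rewrite /upper_triangular_with /word_eval !big_cons big_nil /= mulr1.
  (* The entry is minus the claimed eigenvalue, which is the same class in PSL(2, C). *)
  by have [-> ->] := longitude_entry; split=> //; right.
Qed.

End Representation.

(** * Solutions and A-polynomials *)


Section Solutions.
Variables (C : fieldType) (p q : nat).
Hypotheses (p3 : (3 <= p)%N) (q3 : (3 <= q)%N).

Definition curve_root (m x y : C) :=
  glued_root m (cheb x p) (cheb x p.-1) (cheb y q) (cheb y q.-1).

Lemma gluing_curve_of_solution m s (gamma : edge -> C) :
  is_solution p q m s gamma ->
  exists x y, gluing_curve p q m x y /\ s = curve_root m x y.
Proof.
case=> [[/eqP m0 /eqP s0] gn' in1 in2 eqs].
have gn e : gamma e != 0 by apply/eqP.
have T1 : tail_equation gamma tail1 p = 0 by apply: eqs; rewrite !inE eqxx !orbT.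
have T2 : tail_equation gamma tail2 q = 0 by apply: eqs; rewrite !inE eqxx !orbT.
have [a1 b1] := tail_cheb p3 gn in1 T1.
have [a2 b2] := tail_cheb q3 gn in2 T2.
exists (tail_trace gamma tail1), (tail_trace gamma tail2).
set x := tail_trace gamma tail1 in a1 b1 *; set y := tail_trace gamma tail2 in a2 b2 *.
have nz t : (gamma (EO0 t) != 0) * (gamma (EO1 t) != 0) by [].
have nz1 := nz tail1; have nz2 := nz tail2; rewrite a1 b1 in nz1; rewrite a2 b2 in nz2.
have D k : (k < 6)%N -> nth 0 (equations p q m s gamma) k = 0.
  by move=> k6; apply/eqs/mem_nth; apply: leq_trans k6 _.
have := D 0%N isT; have := D 1%N isT; have := D 2%N isT; have := D 3%N isT.
have := D 4%N isT; have := D 5%N isT; rewrite /equations /= a1 b1 a2 b2.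
move=> D5 D4 D3 D2 D1 D0.
have cA := cheb_cassini_pred x (ltn_trans (isT : 0 < 2)%N p3).
have cB := cheb_cassini_pred y (ltn_trans (isT : 0 < 2)%N q3).
have nzP : [/\ gamma (EP tail1) != 0, gamma (EP tail2) != 0, gamma E0 != 0,
  gamma E1 != 0 & s != 0] by [].
have nzA : [/\ cheb x p != 0, cheb x p.-1 != 0, cheb y q != 0 & cheb y q.-1 != 0].
  move: nz1 nz2; rewrite !mulf_eq0 !negb_or.
  by move=> [/andP[_ ->] /andP[_ ->]] [/andP[_ ->] /andP[_ ->]].
by have [G ->] := glued_of_gluing m0 cA cB nzP nzA D0 D1 D2 D3 D4 D5.
Qed.

Lemma solution_of_gluing_curve m x y e :
  gluing_curve p q m x y -> nonzero_cheb p x -> nonzero_cheb q y ->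
  eliminated (@is_solution C p q) e m (curve_root m x y).
Proof.
move=> [m0 G] xp yq.
have [ip ip'] : (1 < p <= p /\ 1 < p.-1 <= p)%N by split; lia.
have [iq iq'] : (1 < q <= q /\ 1 < q.-1 <= q)%N by split; lia.
have cA := cheb_cassini_pred x (ltn_trans (isT : 0 < 2)%N p3).
have cB := cheb_cassini_pred y (ltn_trans (isT : 0 < 2)%N q3).
have [nA nA' nB nB'] := And4 (xp _ ip) (xp _ ip') (yq _ iq) (yq _ iq').
have [_ _ [nA1 nA2] [nB1 nB2]] := G.
pose A := cheb x p; pose A' := cheb x p.-1; pose B := cheb y q; pose B' := cheb y q.-1.
pose rho := A * (m * B + B') / (B * (A + m * A')).
have rn : rho != 0 by rewrite !(mulf_neq0, invr_neq0).
pose gamma P (e : edge) : C := match e with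
  | E0 => P * rho * B * (m * A + A')
  | E1 => P * A * (m * B + B')
  | EP tail1 => P | EO0 tail1 => P * A | EO1 tail1 => P * A'
  | EP tail2 => P * rho | EO0 tail2 => P * rho * B | EO1 tail2 => P * rho * B'
  end.
have gammaM P e' : gamma P e' = P * gamma 1 e'.
  by case: e' => [||[]|[]|[]]; rewrite /=; ring.
have gn P e' : P != 0 -> gamma P e' != 0.
  by move=> Pn; case: e' => [||[]|[]|[]]; rewrite /= ?mulf_neq0 ?invr_neq0 ?mulf_neq0.
have g1 : gamma 1 e != 0 by rewrite gn ?oner_eq0.
(* The common scale [P] normalises whichever variable is set to 1. *)
pose P := (gamma 1 e)^-1; have Pn : P != 0 by rewrite invr_eq0.
exists (gamma P); split; first by rewrite gammaM mulVf.
have gnP e' : gamma P e' != 0 by apply: gn.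
have [i1 t1] := @cheb_tail _ (gamma P) tail1 p x p3 gnP xp erefl erefl.
have [i2 t2] := @cheb_tail _ (gamma P) tail2 q y q3 gnP yq erefl erefl.
have sn : curve_root m x y != 0.
  by rewrite /curve_root /glued_root !(mulf_neq0, invr_neq0).
split=> //; [by split; apply/eqP | by move=> e'; apply/eqP|].
have [D0 D1 D2 [D3 D4 D5]] := gluing_of_glued m0 cA cB P G.
by move=> w; rewrite !inE; do 7?[case/orP]; move/eqP=> ->.
Qed.

End Solutions.

(** * Signs of the eigenvalues and parity in M *)

Section SignSymmetries.
Variable C : closedFieldType.
Implicit Types (A f : {poly {poly C}}).

Definition flipY A : {poly {poly C}} := map_poly (comp_poly (- 'X)) A.

Lemma flipYK : involutive flipY.
Proof.
move=> A; rewrite /flipY -map_poly_comp map_poly_id // => c _ /=.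
by rewrite -comp_polyA rmorphN /= comp_polyX opprK comp_polyXr.
Qed.

Lemma flipYM A f : flipY (A * f) = flipY A * flipY f.
Proof. exact: rmorphM. Qed.

Lemma horner2_flipY A x y : (flipY A).[x, y] = A.[x, - y].
Proof.
rewrite !horner2E /flipY -map_poly_comp; congr (_.[_]).
by apply: eq_map_poly => c; rewrite /= /horner_eval horner_comp hornerN hornerX.
Qed.

Lemma horner2_even_odd A x y :
  A.[x, y] = (even_poly A).[x ^+ 2, y] + (odd_poly A).[x ^+ 2, y] * x.
Proof.
rewrite -{1}(poly_even_odd A) hornerD hornerMX !horner_comp hornerXn -polyC_exp.
by rewrite hornerD hornerM hornerC.
Qed.

Lemma substitute_eigenvalues_dvd A f h0 h1 :
  flipY (even_poly A) = h0 * f -> flipY (odd_poly A) = h1 * f ->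
  exists h, A = h * substitute_eigenvalues f.
Proof.
move=> /(congr1 flipY) E0 /(congr1 flipY) E1.
exists ((flipY h0 \Po 'X^2) + (flipY h1 \Po 'X^2) * 'X).
rewrite -{1}(poly_even_odd A) -[even_poly A]flipYK -[odd_poly A]flipYK E0 E1.
rewrite !flipYM !comp_polyM -[flipY f \Po _]/(substitute_eigenvalues f).
by rewrite mulrDl [X in _ = _ + X]mulrAC.
Qed.

(** If [S] were dense, every line 'X = x would belong to its curve part, and [f] would vanish
    identically. So a nonzero polynomial vanishes on [S], and [curve_part_vanishes_almost]
    applies. *)
Lemma defining_polynomial_almost (S : C -> C -> Prop) f :
  defining_polynomial S f -> vanishes_almost_on S f.
Proof.
move=> [fn Hf]; have Vf : vanishes_on (curve_part S) f.
  by apply/Hf; exists 1; rewrite mul1r.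
have [[g [/eqP gn Sg]]|Hdense] := pselect (exists g, g <> 0 /\ vanishes_on S g).
  exact/(curve_part_vanishes_almost _ gn (vanishes_on_almost Sg)).
have dense g : vanishes_on S g -> g = 0.
  by move=> Sg; apply: contrapT => gn; apply: Hdense; exists g.
exfalso; apply: fn; apply/polyP => i; rewrite coef0.
apply: (@poly_eq0_off_seq _ _ [::]) => y _.
suff E : map_poly (horner_eval y) f = 0.
  by rewrite -[LHS](coef_map (horner_eval y)) E coef0.
apply: (@poly_eq0_off_seq _ _ [::]) => x _; rewrite -horner2E.
apply: Vf; exists ('X - x%:P%:P); split.
- case=> c /(congr1 (fun P : {poly {poly C}} => size P)).
  by rewrite size_XsubC size_polyC; case: eqP.
- by move=> u v _ g /dense->; rewrite !horner0.
- by rewrite hornerXsubC subrr horner0.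
Qed.

End SignSymmetries.

Lemma PSL_eigenvalues_sign (C : fieldType) (K : knot_group) (M L M' L' : C) :
  M' = M \/ M' = - M -> L' = L \/ L' = - L ->
  PSL_eigenvalues K M L -> PSL_eigenvalues K M' L'.
Proof.
have up (X : 'M[C]_2) a a' : a' = a \/ a' = - a ->
    upper_triangular_with X a -> upper_triangular_with X a'.
  case=> -> [X10 X00]; split=> //; rewrite opprK.
  by case: X00 => ->; [right|left].
by move=> sM sL [rho [R HM HL]]; exists rho; split => //; [apply: up HM|apply: up HL].
Qed.

Section Main.
Variable C : numClosedFieldType.

Lemma double_twist_defining_equations p q : (3 <= p)%N -> (3 <= q)%N ->
  are_defining_equations (double_twist_knot p q) (@is_solution C p q).
Proof.
move=> p3 q3 e; set S := eliminated _ e.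
have p0 := ltnW (ltnW p3); have q0 := ltnW (ltnW q3).
have S_curve m s : S m s -> exists x y, gluing_curve p q m x y /\ s = curve_root p q m x y.
  by case=> gamma [_ /gluing_curve_of_solution]; apply.
have [g gn Hg] := gluing_curve_not_dense C p3 q3.
have Sg : vanishes_almost_on S g.
  by apply: vanishes_on_almost => m s /S_curve[x [y [G ->]]]; apply: Hg.
have [f fn Hf] := almost_ideal_principal gn Sg.
have [F HF] : vanishes_almost_on S f by apply/Hf; exists 1; rewrite mul1r.
exists f; split.
- split; first exact/eqP.
  by move=> u; apply: iff_trans (curve_part_vanishes_almost u gn Sg) (Hf u).
- case=> c Dc; have cn : c != 0 by apply: contraNneq fn => c0; rewrite Dc c0.
  (* A nonzero constant cannot vanish at a solution outside the finite set [F]. *)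
  have [m [x [y [mF G xp yq]]]] := gluing_curve_infinite (map fst F) p3 q3.
  have nF : (m, curve_root p q m x y) \notin F.
    by apply: contra mF => mF; apply/mapP; exists (m, curve_root p q m x y).
  have /eqP := HF _ _ (solution_of_gluing_curve p3 q3 e G xp yq) nF.
  by rewrite Dc !hornerC (negPf cn).
move=> A /defining_polynomial_almost[FA HA].
(* The exceptional points of [A] are carried over by (M, L) to (M^2, - L). Both square roots M and -
   M of m occur as eigenvalues, which separates the even and odd parts. *)
have eo m s : S m s -> (m, s) \notin [seq (z.1 ^+ 2, - z.2) | z <- FA] ->
    (even_poly A).[m, - s] = 0 /\ (odd_poly A).[m, - s] = 0.
  move=> /S_curve[x [y [G Ds]]] nF; pose M := sqrtC m.
  have M2 : M ^+ 2 = m by rewrite sqrtCK.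
  have m0 : m != 0 := G.1.
  have M0 : M != 0 by rewrite sqrtC_eq0.
  have T : PSL_eigenvalues (double_twist_knot p q) M s.
    by rewrite Ds /curve_root -M2; apply: PSL_eigenvalues_gluing_curve; rewrite ?M2.
  have AM M' : M' = M \/ M' = - M -> A.[M', - s] = 0.
    move=> HM; apply: HA; first by apply: PSL_eigenvalues_sign T => //; right.
    apply: contra nF => MF; apply/mapP; exists (M', - s) => //=.
    by rewrite opprK -M2; case: HM => ->; rewrite ?sqrrN.
  have split_even (a b : C) : a + b * M = 0 -> a + b * - M = 0 -> a = 0 /\ b = 0.
    move=> Ep Em; have a0 : a = 0.
      apply: (mulfI (_ : 2%:R != 0)); first by rewrite pnatr_eq0.
      transitivity (a + b * M + (a + b * - M)); first by ring.
      by rewrite Ep Em addr0 mulr0.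
    by split=> //; apply: (mulIf M0); rewrite -[LHS]add0r -{1}a0 Ep mul0r.
  apply: split_even.
    by rewrite -[RHS](AM M (or_introl erefl)) (horner2_even_odd A) M2.
  by rewrite -[RHS](AM (- M) (or_intror erefl)) (horner2_even_odd A) sqrrN M2.
have [h0 E0] : exists h, flipY (even_poly A) = h * f.
  apply/Hf; exists [seq (z.1 ^+ 2, - z.2) | z <- FA] => m s Sms nF.
  by rewrite horner2_flipY; case: (eo m s Sms nF).
have [h1 E1] : exists h, flipY (odd_poly A) = h * f.
  apply/Hf; exists [seq (z.1 ^+ 2, - z.2) | z <- FA] => m s Sms nF.
  by rewrite horner2_flipY; case: (eo m s Sms nF).
exact: substitute_eigenvalues_dvd E0 E1.
Qed.

End Main.

Theorem corollary5p32 (R : realType) (p q : nat)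
    (hp : (3 <= p)%N) (hq : (3 <= q)%N) :
  are_defining_equations (C := R[i]) (double_twist_knot p q)
    (@is_solution R[i] p q).
Proof. exact: double_twist_defining_equations. Qed.
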